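(* Let $K$ be a field and let $A:=\sigma(R)\langle x_1,\dots,x_n\rangle$ be a bijective skew $PBW$ extension of a ring $R$ that satisfies the following conditions: (i) $R$ and $A$ are $K$-algebras. (ii) $\mathrm{lgld}(R)<\infty$, where $\mathrm{lgld}$ denotes the left global dimension. (iii) $R$ is a finitely semi-graded ring with semi-graduation $R=\bigoplus_{p\geq 0}R_p$. (iv) $R$ is connected, i.e., $R_0=K$. (v) For $1\leq i\leq n$, the maps $\sigma_i,\delta_i:R\to R$ determined by $x_ir=\sigma_i(r)x_i+\delta_i(r)$ ($r\in R$) are homogeneous (they map $R_p$ into $R_p$ for every $p\ge 0$), and there exist $i,j$ such that the parameter $d_{ij}\in R$ in the relation $$x_jx_i=c_{ij}x_ix_j+a_{ij}^{(1)}x_1+\cdots+a_{ij}^{(n)}x_n+d_{ij}$$ (with $c_{ij},a_{ij}^{(k)},d_{ij}\in R$) satisfies $d_{ij}\in K-\{0\}$. Then $A$ is a left semi-graded Artin-Schelter regular algebra.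
   Context: Skew $PBW$ extensions. Let $R\subseteq A$ be rings. $A$ is a skew $PBW$ extension of $R$, written $A=\sigma(R)\langle x_1,\dots,x_n\rangle$, if: there are finitely many elements $x_1,\dots,x_n\in A$ such that $A$ is a free left $R$-module with basis the standard monomials $x^\alpha=x_1^{\alpha_1}\cdots x_n^{\alpha_n}$, $\alpha\in\mathbb{N}^n$ ($0\in\mathbb{N}$); for every $1\le i\le n$ and $r\in R-\{0\}$ there is $c_{i,r}\in R-\{0\}$ with $x_ir-c_{i,r}x_i\in R$; and for all $1\le i,j\le n$ there is $c_{i,j}\in R-\{0\}$ with $x_jx_i-c_{i,j}x_ix_j\in R+Rx_1+\cdots+Rx_n$. For each $i$ there are then an injective ring endomorphism $\sigma_i$ of $R$ and a $\sigma_i$-derivation $\delta_i$ of $R$ with $x_ir=\sigma_i(r)x_i+\delta_i(r)$ for all $r\in R$, and for all $1\le i,j\le n$ there are unique constants $c_{ij},a_{ij}^{(k)},d_{ij}\in R$ with $x_jx_i=c_{ij}x_ix_j+\sum_k a_{ij}^{(k)}x_k+d_{ij}$. $A$ is bijective if every $\sigma_i$ is bijective and $c_{ij}$ is invertible for all $1\le i<j\le n$. Semi-graded rings. A ring $B$ is semi-graded (SG) if there is a collection $\{B_p\}_{p\ge 0}$ of subgroups of its additive group with $B=\bigoplus_{p\ge0}B_p$, $B_mB_p\subseteq B_0\oplus\cdots\oplus B_{m+p}$ for all $m,p\ge0$, and $1\in B_0$. $B$ is finitely semi-graded (FSG) if it is SG, there are finitely many elements of $B$ that together with $B_0$ generate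 $B$ as a ring, and every $B_p$ is a free $B_0$-module of finite dimension. A left ideal $I$ of $B$ is semi-graded if $I=\bigoplus_{p}(I\cap B_p)$. $B_{\ge1}$ denotes the least two-sided ideal of $B$ that contains $\bigoplus_{p\ge1}B_p$ and is semi-graded as a left ideal. A $K$-algebra $B$ is a left semi-graded Artin-Schelter regular algebra ($\mathcal{SAS}$) if: (1) $B$ is an FSG ring with semi-graduation $B=\bigoplus_{p\ge0}B_p$; (2) $B$ is connected, i.e. $B_0=K$; (3) $\mathrm{lgld}(B)=:d<\infty$; (4) $\mathrm{Ext}^i_B({}_B(B/B_{\ge1}),{}_BB)$ is $0$ if $i\ne d$ and is isomorphic to $(B/B_{\ge1})_B$ as a right $B$-module if $i=d$. *)

(* Defs.v *)
From HB Require Import structures.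
From mathcomp Require Import all_boot all_algebra.
From mathcomp Require Import boolp classical_sets functions.
From mathcomp Require Import generic_quotient ring_quotient.

Set Implicit Arguments.
Unset Strict Implicit.
Unset Printing Implicit Defensive.

Import GRing.Theory.

Local Open Scope classical_set_scope.
Local Open Scope ring_scope.

(* Left modules over a ring S are lmodType S; right modules over S are
   lmodType S^c, with S^c the converse ring. Thus S^o is S as a left S-module
   and (S^c)^o is S as a right S-module: its scaling is b *: x = x * b. *)

Section Submodule.
Variables (S : pzRingType) (V : lmodType S) (Z : submodClosed V).

Record submodule := Submodule {
  submodule_val :> V;
  submodule_valP : submodule_val \in Z }.

HB.instance Definition _ := [isSub for submodule_val].
HB.instance Definition _ := [Choice of submodule by <:].
HB.instance Definition _ := [SubChoice_isSubLmodule of submodule by <:].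

End Submodule.

Section QuotientModule.
Variables (S : pzRingType) (V : lmodType S) (N : submodClosed V).
Local Open Scope quotient_scope.

(* Quotient.quot expects a zmodClosed predicate, which a submodClosed one is
   not by inheritance; closure under opposites comes from the scaling by -1. *)
Definition quotmod_pred : {pred V} := N.

Fact quotmod_pred_zmod_closed : zmod_closed quotmod_pred.
Proof. exact: GRing.submod_closedB (GRing.submodClosedP N). Qed.

HB.instance Definition _ :=
  GRing.isZmodClosed.Build V quotmod_pred quotmod_pred_zmod_closed.

Definition quotmod := Quotient.quot quotmod_pred.

HB.instance Definition _ := GRing.Zmodule.on quotmod.

Definition quotmod_scale (a : S) (u : quotmod) : quotmod :=
  \pi_quotmod (a *: repr u).

Lemma pi_quotmodE (v w : V) :
  \pi_quotmod v = \pi_quotmod w <-> v - w \in N.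
Proof.
split=> [e|h]; first by rewrite (Quotient.idealrBE quotmod_pred v w); apply/eqP.
by apply/eqP; rewrite -(Quotient.idealrBE quotmod_pred v w).
Qed.

Lemma quotmod_scaleE (a : S) (v : V) :
  quotmod_scale a (\pi_quotmod v) = \pi_quotmod (a *: v).
Proof.
apply/pi_quotmodE; rewrite -scalerBr rpredZ //.
by apply/pi_quotmodE; rewrite reprK.
Qed.

Lemma pi_quotmodD (v w : V) :
  \pi_quotmod (v + w) = \pi_quotmod v + \pi_quotmod w.
Proof. by rewrite !piE. Qed.

Lemma pi_quotmod_surj (u : quotmod) : exists v, u = \pi_quotmod v.
Proof. by exists (repr u); rewrite reprK. Qed.

Fact quotmod_scaleA a b (u : quotmod) :
  quotmod_scale a (quotmod_scale b u) = quotmod_scale (a * b) u.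
Proof.
by have [v ->] := pi_quotmod_surj u; rewrite !quotmod_scaleE scalerA.
Qed.

Fact quotmod_scale1 : left_id 1 quotmod_scale.
Proof.
by move=> u; have [v ->] := pi_quotmod_surj u; rewrite quotmod_scaleE scale1r.
Qed.

Fact quotmod_scaleDr : right_distributive quotmod_scale +%R.
Proof.
move=> a u1 u2.
have [v ->] := pi_quotmod_surj u1; have [w ->] := pi_quotmod_surj u2.
by rewrite -pi_quotmodD !quotmod_scaleE scalerDr pi_quotmodD.
Qed.

Fact quotmod_scaleDl (u : quotmod) : {morph quotmod_scale^~ u : a b / a + b}.
Proof.
move=> a b; have [v ->] := pi_quotmod_surj u.
by rewrite !quotmod_scaleE scalerDl pi_quotmodD.
Qed.

HB.instance Definition _ := GRing.Zmodule_isLmodule.Build S quotmod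
  quotmod_scaleA quotmod_scale1 quotmod_scaleDr quotmod_scaleDl.

End QuotientModule.

Definition mod_iso (S : pzRingType) (U V : lmodType S) : Prop :=
  exists f : {linear U -> V}, bijective f.

Definition projective (S : pzRingType) (P : lmodType S) : Prop :=
  forall (M N : lmodType S) (g : {linear M -> N}) (f : {linear P -> N}),
    (forall y, exists x, g x = y) ->
    exists h : {linear P -> M}, forall p, g (h p) = f p.

Record proj_resolution (S : pzRingType) (M : lmodType S) := ProjResolution {
  res_mod :> nat -> lmodType S;
  res_d : forall i, {linear res_mod i.+1 -> res_mod i};
  res_aug : {linear res_mod 0%N -> M};
  res_projective : forall i, projective (res_mod i);
  res_aug_surj : forall y, exists p, res_aug p = y;
  res_exact0 : forall p, res_aug p = 0 <-> exists q, res_d 0 q = p;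
  res_exactS : forall i p, res_d i p = 0 <-> exists q, res_d i.+1 q = p }.

Definition pd_le (S : pzRingType) (M : lmodType S) (m : nat) : Prop :=
  exists P : proj_resolution M, forall i, (m < i)%N -> forall p : P i, p = 0.

Definition lgld_le (S : pzRingType) (m : nat) : Prop :=
  forall M : lmodType S, pd_le M m.

Definition lgld_eq (S : pzRingType) (m : nat) : Prop :=
  lgld_le S m /\ forall m', lgld_le S m' -> (m <= m')%N.

(* Ext^i_S(M, S) with its right S-module structure, computed from a projective
   resolution P of M: the i-th cohomology of Hom_S(P, S). The right action on
   Hom_S(P_i, S) is (f . b)(p) = f(p) * b, which is the pointwise scaling of
   functions P_i -> (S^c)^o. *)
Section Ext.
Variables (S : pzRingType) (M : lmodType S) (P : proj_resolution M).

Definition is_cocycle i (f : P i -> S) : Prop :=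
  linear (f : P i -> S^o) /\ forall p, f (res_d P i p) = 0.

Definition is_coboundary i : (P i -> S) -> Prop :=
  match i with
  | 0 => fun f => forall p, f p = 0
  | j.+1 => fun f => exists2 g : P j -> S,
      linear (g : P j -> S^o) & forall p, f p = g (res_d P j p)
  end.

Definition cocycle i : {pred P i -> (S^c)^o} := fun f => `[< is_cocycle f >].

Fact cocycle_closed i : submod_closed (@cocycle i).
Proof.
split=> [|b f g /asboolP[lf f0] /asboolP[lg g0]]; apply/asboolP; split.
- by move=> a u v /=; rewrite /GRing.zero /= scaler0 addr0.
- by [].
- move=> a u v /=.
  have -> w : (b *: f + g) w = (f w : S) * b + g w by [].
  rewrite (lf a u v) (lg a u v) /GRing.scale /=.
  by rewrite mulrDl mulrDr -mulrA addrACA.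
- move=> p.
  have -> : (b *: f + g) (res_d P i p) =
    (f (res_d P i p) : S) * b + g (res_d P i p) by [].
  by rewrite f0 g0 mul0r addr0.
Qed.

HB.instance Definition _ i :=
  GRing.isSubmodClosed.Build S^c (P i -> (S^c)^o) (@cocycle i)
    (cocycle_closed i).

Definition coboundary i : {pred submodule (@cocycle i)} :=
  fun f => `[< is_coboundary (submodule_val f) >].

Fact coboundary_closed i : submod_closed (@coboundary i).
Proof.
case: i => [|i]; split=> [|b f g]; rewrite /in_mem /=.
- by apply/asboolP.
- move=> /asboolP f0 /asboolP g0; apply/asboolP=> p /=.
  rewrite -[LHS]/((submodule_val f p : S) * b + submodule_val g p).
  by rewrite f0 g0 mul0r addr0.
- apply/asboolP; exists (fun=> 0) => // a u v.
  by rewrite scaler0 addr0.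
- move=> /asboolP[f' lf ff'] /asboolP[g' lg gg']; apply/asboolP.
  exists (fun p => f' p * b + g' p) => [a u v|p] /=.
    rewrite (lf a u v) (lg a u v) /GRing.scale /=.
    by rewrite mulrDl mulrDr -mulrA addrACA.
  rewrite -[LHS]/((submodule_val f p : S) * b + submodule_val g p).
  by rewrite ff' gg'.
Qed.

HB.instance Definition _ i :=
  GRing.isSubmodClosed.Build S^c (submodule (@cocycle i)) (@coboundary i)
    (coboundary_closed i).

Definition Ext i : lmodType S^c := quotmod (@coboundary i).

End Ext.

Section SemiGraded.
Variables (B : nzRingType).
Implicit Types (D : set B) (gB : nat -> set B).

Definition partial_sum gB (N : nat) : set B :=
  [set b | exists2 f : nat -> B,
     (forall p, gB p (f p)) & b = \sum_(p < N) f p].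

(* D is the internal direct sum of the gB p, p >= 0. *)
Definition internal_direct_sum D gB : Prop :=
  (forall b, D b <-> exists N, partial_sum gB N b) /\
  (forall N (f : nat -> B), (forall p, gB p (f p)) ->
     \sum_(p < N) f p = 0 -> forall p, (p < N)%N -> f p = 0).

Definition additive_subgroup D : Prop :=
  D 0 /\ forall u v, D u -> D v -> D (u - v).

Record semi_graded gB : Prop := SemiGraded {
  sg_subgroup : forall p, additive_subgroup (gB p);
  sg_direct_sum : internal_direct_sum setT gB;
  sg_mul : forall m p u v, gB m u -> gB p v ->
    partial_sum gB (m + p).+1 (u * v);
  sg_one : gB 0%N 1 }.

Definition subring D : Prop :=
  [/\ D 1, forall u v, D u -> D v -> D (u - v)
    & forall u v, D u -> D v -> D (u * v)].

Definition free_finite_dim (B0 D : set B) : Prop :=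
  exists m (e : 'I_m -> B),
    (forall v, D v <-> exists2 c : 'I_m -> B,
       (forall i, B0 (c i)) & v = \sum_i c i * e i) /\
    (forall c : 'I_m -> B, (forall i, B0 (c i)) ->
       \sum_i c i * e i = 0 -> forall i, c i = 0).

Record finitely_semi_graded gB : Prop := FinitelySemiGraded {
  fsg_semi_graded : semi_graded gB;
  fsg_generated : exists s : seq B, forall D, subring D ->
    gB 0%N `<=` D -> (forall b, b \in s -> D b) -> D = setT;
  fsg_free : forall p, free_finite_dim (gB 0%N) (gB p) }.

Definition two_sided_ideal D : Prop :=
  [/\ D 0, forall u v, D u -> D v -> D (u + v)
    & forall b u, D u -> D (b * u) /\ D (u * b)].

Definition semi_graded_left_ideal gB D : Prop :=
  internal_direct_sum D (fun p => D `&` gB p).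

Definition contains_positive_part gB D : Prop :=
  forall p, (0 < p)%N -> gB p `<=` D.

(* The ideal B_{>=1}: the intersection of all two-sided ideals of B that
   contain every gB p with p >= 1 and are semi-graded as left ideals. *)
Definition ge1_ideal gB : set B :=
  [set b | forall I : set B, two_sided_ideal I ->
     contains_positive_part gB I -> semi_graded_left_ideal gB I -> I b].

Definition ge1_left gB : {pred B^o} := fun b => `[< ge1_ideal gB b >].
Definition ge1_right gB : {pred (B^c)^o} := fun b => `[< ge1_ideal gB b >].

Fact ge1_left_closed gB : submod_closed (ge1_left gB).
Proof.
split=> [|a u v /asboolP hu /asboolP hv]; apply/asboolP=> I hI hp hs.
  by case: hI.
have [_ hD hM] := hI.
by apply: hD; [exact: (hM a u (hu I hI hp hs)).1 | exact: hv].
Qed.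

Fact ge1_right_closed gB : submod_closed (ge1_right gB).
Proof.
split=> [|a u v /asboolP hu /asboolP hv]; apply/asboolP=> I hI hp hs.
  by case: hI.
have [_ hD hM] := hI.
by apply: hD; [exact: (hM a u (hu I hI hp hs)).2 | exact: hv].
Qed.

HB.instance Definition _ gB := GRing.isSubmodClosed.Build B B^o (ge1_left gB)
  (ge1_left_closed gB).
HB.instance Definition _ gB :=
  GRing.isSubmodClosed.Build B^c (B^c)^o (ge1_right gB) (ge1_right_closed gB).

Definition left_quot_ge1 gB : lmodType B := quotmod (ge1_left gB).
Definition right_quot_ge1 gB : lmodType B^c := quotmod (ge1_right gB).

End SemiGraded.

Definition connected (K : fieldType) (B : algType K) (gB : nat -> set B) :
  Prop := gB 0%N = [set k%:A | k in [set: K]].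

(* Ext does not depend on the projective resolution, so the last condition is
   required of the cohomology of every resolution; lgld_eq B d provides
   resolutions of every module, so there is at least one. *)
Definition SAS (K : fieldType) (B : algType K) : Prop :=
  exists (gB : nat -> set B) (d : nat),
    [/\ finitely_semi_graded gB,
        connected gB,
        lgld_eq B d
      & forall P : proj_resolution (left_quot_ge1 gB),
          (forall i, i <> d -> forall u : Ext P i, u = 0) /\
          mod_iso (Ext P d) (right_quot_ge1 gB)].

Section SkewPBW.
Variables (K : fieldType) (R A : algType K) (n : nat).
Variables (iota : {lrmorphism R -> A}) (x : 'I_n -> A).

Definition std_monomial (alpha : {ffun 'I_n -> nat}) : A :=
  \prod_(i < n) x i ^+ alpha i.

Definition std_combination (s : seq {ffun 'I_n -> nat})
    (r : {ffun 'I_n -> nat} -> R) : A :=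
  \sum_(alpha <- s) iota (r alpha) * std_monomial alpha.

Record skew_PBW : Prop := SkewPBW {
  pbw_inj : injective iota;
  pbw_span : forall a : A, exists s r, a = std_combination s r;
  pbw_free : forall s r, uniq s -> std_combination s r = 0 ->
    forall alpha, alpha \in s -> r alpha = 0;
  pbw_comm_scalar : forall i r, r != 0 -> exists2 c, c != 0 &
    exists r', x i * iota r - iota c * x i = iota r';
  pbw_comm_var : forall i j, exists2 c, c != 0 &
    exists (a : 'I_n -> R) (d : R),
      x j * x i - iota c * (x i * x j) =
        iota d + \sum_k iota (a k) * x k }.

Definition pbw_twists (sigma delta : 'I_n -> R -> R) : Prop :=
  forall i r, x i * iota r = iota (sigma i r) * x i + iota (delta i r).

Definition pbw_constants (c : 'I_n -> 'I_n -> R)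
    (a : 'I_n -> 'I_n -> 'I_n -> R) (d : 'I_n -> 'I_n -> R) : Prop :=
  forall i j, x j * x i =
    iota (c i j) * (x i * x j) + \sum_k iota (a i j k) * x k + iota (d i j).

End SkewPBW.

Definition invertible (R : pzRingType) (r : R) : Prop :=
  exists s, s * r = 1 /\ r * s = 1.

Definition bijective_pbw (R : pzRingType) n (sigma : 'I_n -> R -> R)
    (c : 'I_n -> 'I_n -> R) : Prop :=
  (forall i, bijective (sigma i)) /\
  (forall i j : 'I_n, (i < j)%N -> invertible (c i j)).

Definition homogeneous (R : pzRingType) (R_ : nat -> set R) (f : R -> R) :
  Prop := forall p, {homo f : r / R_ p r}.

(* Main.v *)
Require Import Defs.
From HB Require Import structures.
From mathcomp Require Import all_boot all_algebra.
From mathcomp Require Import boolp classical_sets functions.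
From mathcomp Require Import generic_quotient ring_quotient.

(** Idea. The relation with [d i j] in [K - {0}] puts a unit of [K] into any
    two-sided ideal containing the variables. For a semi-graduation of [A] with
    all variables in degree 1 we therefore get [A_{>=1} = A], and every Ext
    group in condition (4) is computed on the zero module, whose projective
    resolutions are contractible.

    Since the coefficients [c i j] and [a i j k] need not be homogeneous, the
    semi-graduation is not the obvious one coming from [R]. Instead, filter [A]
    by word length in the variables followed by generators of [R], and choose
    complements of each filtration step in the next one by selecting linearly
    independent words greedily.

    For the finiteness of [lgld A], view an [A]-module as filtered by [F 0 = 0]
    and [F k.+1] everything, and cover it repeatedly by filtered free modules.
    In the associated graded modules the variables act as normal elements, and
    each passage to a kernel makes one more of them regular. After [n] steps all
    of them are regular, and then projectivity (more generally projective
    dimension) over [A] can be tested over [R] on the graded pieces of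
    [N / (x_1 N + ... + x_n N)]. This gives [lgld A <= n + lgld R]. *)

Set Implicit Arguments.
Unset Strict Implicit.
Unset Printing Implicit Defensive.

Import GRing.Theory.
Local Open Scope ring_scope.

(** * Projective dimension *)

(** The associated graded ring is never built: graded pieces, ideals generated by variables and
    regularity are all expressed by [R]-submodules of the filtered module itself. Since filtrations
    start at [F 0 = 0], the quotient of [F k.+1] by [F k] is the piece of degree [k], and inductions
    on [k] start from the zero module. Normality of the variables comes from the surjectivity of
    each [sigma i], their regularity on [A] from its injectivity. In the semi-graduation the
    delicate point is that every variable must be selected in degree 1. The variables are linearly
    independent together with 1, and they are listed before the generators of [R], so the greedy
    choice cannot discard them. The two halves meet only in the number [d]: the semi-graduation
    settles the Ext condition in every degree at once, so [d] can be the least bound obtained from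
    the dimension argument. *)

Lemma linear_ex (S : pzRingType) (U V : lmodType S) (f : U -> V) :
  linear f -> exists g : {linear U -> V}, g =1 f.
Proof.
move=> lf.
pose m := GRing.isLinear.Build _ _ _ _ f lf.
pose g : {linear U -> V} := HB.pack f m.
by exists g.
Qed.

(** Closed predicates become, once and for all, an abstract module with an injection, so that
    kernels and pullbacks below involve no packed predicates. *)
Lemma submodule_ex (S : pzRingType) (V : lmodType S) (Z : V -> Prop) :
  Z 0 -> (forall a u v, Z u -> Z v -> Z (a *: u + v)) ->
  exists (W : lmodType S) (i : {linear W -> V}),
    injective i /\ forall v, Z v <-> exists w, i w = v.
Proof.
move=> Z0 ZD.
pose z : {pred V} := fun v => `[< Z v >].
have zE v : (v \in z) = `[< Z v >] by [].
have zc : submod_closed z.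
  split=> [|a u v]; rewrite !zE; first exact/asboolP.
  by move=> /asboolP hu /asboolP hv; apply/asboolP/ZD.
pose m := GRing.isSubmodClosed.Build S V z zc.
pose C : submodClosed V := HB.pack z m.
have lv : linear (@submodule_val S V C) by [].
have [i iE] := linear_ex lv.
exists (submodule C), i; split=> [u v|v].
  by rewrite !iE; apply: val_inj.
split=> [hv|[w <-]]; last by rewrite iE; apply/asboolP/(submodule_valP w).
have hv' : v \in C by apply/asboolP.
by exists (Submodule hv'); rewrite iE.
Qed.

Lemma pi_quotmod0 (S : pzRingType) (V : lmodType S) (N : submodClosed V) :
  \pi_(quotmod N)%qT 0 = 0 :> quotmod N.
Proof.
have := pi_quotmodD N 0 0; rewrite addr0 => /eqP.
by rewrite -[X in X == _]addr0 (inj_eq (addrI _)) eq_sym => /eqP.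
Qed.

Lemma quotient_ex (S : pzRingType) (V : lmodType S) (Z : V -> Prop) :
  Z 0 -> (forall a u v, Z u -> Z v -> Z (a *: u + v)) ->
  exists (W : lmodType S) (q : {linear V -> W}),
    (forall w, exists v, q v = w) /\ forall v, q v = 0 <-> Z v.
Proof.
move=> Z0 ZD.
pose z : {pred V} := fun v => `[< Z v >].
have zE v : (v \in z) = `[< Z v >] by [].
have zc : submod_closed z.
  split=> [|a u v]; rewrite !zE; first exact/asboolP.
  by move=> /asboolP hu /asboolP hv; apply/asboolP/ZD.
pose m := GRing.isSubmodClosed.Build S V z zc.
pose C : submodClosed V := HB.pack z m.
have lv : linear (fun v => \pi_(quotmod C)%qT v : quotmod C).
  by move=> a u v; rewrite pi_quotmodD -quotmod_scaleE.
have [q qE] := linear_ex lv.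
exists (quotmod C), q; split=> [w|v].
  by have [v ->] := pi_quotmod_surj w; exists v; rewrite qE.
have -> : q v = 0 <-> q v = q 0 by rewrite linear0.
rewrite !qE; rewrite pi_quotmodE subr0.
by split=> [/asboolP|h]; last exact/asboolP.
Qed.

Definition short_exact (S : pzRingType) (U V W : lmodType S)
    (i : {linear U -> V}) (q : {linear V -> W}) : Prop :=
  [/\ injective i, forall w, exists v, q v = w
    & forall v, q v = 0 <-> exists u, i u = v].

Section ProjectiveDimension.
Variable S : pzRingType.
Implicit Types U V W P Q T : lmodType S.

Lemma kernel_ex V W (q : {linear V -> W}) :
  exists U (i : {linear U -> V}),
    injective i /\ forall v, q v = 0 <-> exists u, i u = v.
Proof.
apply: (@submodule_ex _ _ (fun v => q v = 0)) => [|a u v hu hv].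
  exact: linear0.
by rewrite linearP hu hv scaler0 addr0.
Qed.

Lemma linear_factor U V T (i : {linear U -> V}) (f : {linear T -> V}) :
  injective i -> (forall t, exists u, i u = f t) ->
  exists g : {linear T -> U}, forall t, i (g t) = f t.
Proof.
move=> inj /choice[g gE].
have lg : linear g by move=> a u v; apply: inj; rewrite linearP !gE linearP.
by have [g' g'E] := linear_ex lg; exists g' => t; rewrite g'E.
Qed.

Lemma mod_iso_sym V W : mod_iso V W -> mod_iso W V.
Proof.
case=> f [g fK gK].
have lg : linear g by move=> a u v; rewrite -{1}[u]gK -{1}[v]gK -linearP fK.
have [g' g'E] := linear_ex lg.
by exists g', f => x; rewrite g'E.
Qed.

Lemma surj_inj_iso V W (f : {linear V -> W}) :
  injective f -> (forall w, exists v, f v = w) -> mod_iso V W.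
Proof.
move=> fi /choice[g gK]; exists f; exists g => // v.
by apply: fi; rewrite gK.
Qed.

Lemma projective_iso P Q : mod_iso P Q -> projective P -> projective Q.
Proof.
move=> [f [f' fK f'K]] hP M N g k gs.
have lk : linear (k \o f) by move=> a u v; rewrite /= !linearP.
have [kf kfE] := linear_ex lk.
have [h hE] := hP _ _ _ kf gs.
have lh : linear (h \o f').
  by move=> a u v /=; apply/eqP; rewrite -linearP; apply/eqP; congr (h _);
     apply: (can_inj fK); rewrite linearP !f'K.
have [h' h'E] := linear_ex lh.
by exists h' => p; rewrite h'E /= hE kfE /= f'K.
Qed.

Lemma projective_retract P Q (f : {linear P -> Q}) (s : {linear Q -> P}) :
  (forall q, f (s q) = q) -> projective P -> projective Q.
Proof.
move=> fs hP M N g k gs.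
have lk : linear (k \o f) by move=> a u v; rewrite /= !linearP.
have [kf kfE] := linear_ex lk.
have [h hE] := hP _ _ _ kf gs.
have lh : linear (h \o s) by move=> a u v; rewrite /= !linearP.
have [h' h'E] := linear_ex lh.
by exists h' => p; rewrite h'E /= hE kfE /= fs.
Qed.

Lemma projective_prod P Q : projective P -> projective Q ->
  projective (P * Q)%type.
Proof.
move=> hP hQ M N g k gs.
have l1 : linear (fun p : P => k (p, 0)).
  move=> a u v; rewrite -linearP; congr (k _).
  by congr pair; rewrite /= scaler0 addr0.
have l2 : linear (fun q : Q => k (0, q)).
  move=> a u v; rewrite -linearP; congr (k _).
  by congr pair; rewrite /= scaler0 addr0.
have [k1 k1E] := linear_ex l1; have [k2 k2E] := linear_ex l2.
have [h1 h1E] := hP _ _ _ k1 gs; have [h2 h2E] := hQ _ _ _ k2 gs.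
have lh : linear (fun z : P * Q => h1 z.1 + h2 z.2).
  by move=> a u v; rewrite /= !linearP scalerDr addrACA.
have [h hE] := linear_ex lh.
exists h => -[p q]; rewrite hE linearD h1E h2E k1E k2E -linearD; congr (k _).
by congr pair; rewrite /= ?addr0 ?add0r.
Qed.

Lemma split_short_exact U V P (i : {linear U -> V}) (q : {linear V -> P}) :
  short_exact i q -> projective P -> mod_iso (U * P)%type V.
Proof.
move=> [ii qs ex] hP.
have lid : linear (@id P) by [].
have [k kE] := linear_ex lid.
have [h hE] := hP _ _ q k qs.
have lh : linear (fun z : U * P => i z.1 + h z.2).
  by move=> a u v; rewrite /= !linearP scalerDr addrACA.
have [f fE] := linear_ex lh.
have qi u : q (i u) = 0 by apply/ex; exists u.
apply: (@surj_inj_iso _ _ f) => [|v].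
  have f0 z : f z = 0 -> z = 0.
    case: z => u p; rewrite fE /= => e.
    have p0 : p = 0.
      by have := congr1 q e; rewrite linearD qi add0r hE kE linear0.
    move: e; rewrite p0 linear0 addr0 => e.
    by congr pair; apply: ii; rewrite e linear0.
  by move=> y z /eqP; rewrite -subr_eq0 -linearB => /eqP/f0/eqP;
     rewrite subr_eq0 => /eqP.
have /ex[u uE] : q (v - h (q v)) = 0 by rewrite linearB hE kE subrr.
by exists (u, q v); rewrite fE /= uE subrK.
Qed.

(** Dimension shifting is built into the recursion: inductions on [m] handle one presentation at a
    time instead of a whole resolution. [projdim_leP] identifies this notion with [pd_le]. *)
Fixpoint projdim_le (m : nat) W : Prop :=
  match m with
  | 0 => projective W
  | m'.+1 => exists U P (i : {linear U -> P}) (q : {linear P -> W}),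
      [/\ projective P, short_exact i q & projdim_le m' U]
  end.

Lemma projdim_le_iso m V W : mod_iso V W -> projdim_le m V -> projdim_le m W.
Proof.
case: m => [|m]; first exact: projective_iso.
move=> [f [f' fK f'K]] [U [P [i [q [hP [ii qs ex] hU]]]]].
have lq : linear (f \o q) by move=> a u v; rewrite /= !linearP.
have [q' q'E] := linear_ex lq.
exists U, P, i, q'; split=> //; split=> // [w|p].
  by have [p pE] := qs (f' w); exists p; rewrite q'E /= pE f'K.
rewrite q'E /= -ex; split=> [e|->]; last exact: linear0.
by apply: (can_inj fK); rewrite e linear0.
Qed.

Lemma projdim_le_prod m W P : projective P -> projdim_le m W ->
  projdim_le m (W * P)%type.
Proof.
move=> hP; case: m => [|m] hW; first exact: projective_prod.
have [U [T [i [q [hT [ii qs ex] hU]]]]] := hW.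
have li : linear (fun u : U => (i u, 0) : T * P).
  by move=> a u v; rewrite linearP; congr pair; rewrite /= scaler0 addr0.
have lq : linear (fun z : T * P => (q z.1, z.2) : W * P).
  by move=> a u v; rewrite /= linearP.
have [i' i'E] := linear_ex li; have [q' q'E] := linear_ex lq.
exists U, (T * P)%type, i', q'; split=> //; first exact: projective_prod.
split=> [u v|[w p]|[t p]].
- by rewrite !i'E => -[] /ii.
- by have [t tE] := qs w; exists (t, p); rewrite q'E /= tE.
- rewrite q'E /=; split=> [[] /ex[u <-] ->|[u]]; first by exists u; rewrite i'E.
  by rewrite i'E => -[<- <-]; congr pair; apply/ex; exists u.
Qed.

(** Composing a presentation [T -> W * P] with the first projection enlarges its kernel from [U] to
    some [V] with [V / U] isomorphic to [P]. As [P] is projective, [V] is isomorphic to [U * P]. *)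
Lemma projdim_le_cancel m W P : projective P ->
  projdim_le m (W * P)%type -> projdim_le m W.
Proof.
move=> hP; case: m => [|m] /=.
  have l1 : linear (fst : W * P -> W) by [].
  have l2 : linear (fun w : W => (w, 0) : W * P).
    by move=> a u v; congr pair; rewrite /= scaler0 addr0.
  have [f fE] := linear_ex l1; have [s sE] := linear_ex l2.
  by apply: (@projective_retract _ _ f s) => q; rewrite fE sE.
move=> [U [T [i [q [hT [ii qs ex] hU]]]]].
have l1 : linear (fun t => (q t).1) by move=> a u v; rewrite linearP.
have l2 : linear (fun t => (q t).2) by move=> a u v; rewrite linearP.
have [q1 q1E] := linear_ex l1; have [q2 q2E] := linear_ex l2.
have [V [j [jinj jex]]] := kernel_ex q1.
have qi u : q (i u) = 0 by apply/ex; exists u.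
have [i' i'E] : exists i' : {linear U -> V}, forall u, j (i' u) = i u.
  by apply: linear_factor => // u; apply/jex; rewrite q1E qi.
have lq2j : linear (q2 \o j) by move=> a u v; rewrite /= !linearP.
have [r rE] := linear_ex lq2j.
exists V, T, j, q1; split=> //.
  split=> // w; have [t tE] := qs (w, 0); exists t; by rewrite q1E tE.
apply: (projdim_le_iso _ (projdim_le_prod hP hU)).
apply: (@split_short_exact _ _ _ i' r) => //; split=> [u v e|p|v].
- by apply: ii; rewrite -!i'E e.
- have [t tE] := qs (0, p).
  have /jex[v vE] : q1 t = 0 by rewrite q1E tE.
  by exists v; rewrite rE /= vE q2E tE.
- rewrite rE /= q2E; split=> [e|[u <-]]; last by rewrite i'E qi.
  have : q (j v) = 0.
    have := q1E (j v); have -> : q1 (j v) = 0 by apply/jex; exists v.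
    by case: (q (j v)) e => /= ? ? -> <-.
  by case/ex=> u uE; exists u; apply: jinj; rewrite i'E.
Qed.

(* Schanuel's lemma: the pullback of two presentations of [W] splits in two
   ways, so the two kernels agree up to projective summands. *)
Lemma projdim_le_kernel m U Q W (i : {linear U -> Q}) (q : {linear Q -> W}) :
  short_exact i q -> projective Q -> projdim_le m.+1 W -> projdim_le m U.
Proof.
move=> [ii qs ex] hQ [U' [P [i' [p [hP [ii' ps ex'] hU']]]]].
have lE : linear (fun z : P * Q => p z.1 - q z.2).
  by move=> a u v; rewrite /= !linearP addrACA -scalerDr.
have [e eE] := linear_ex lE.
have [E [j [jinj jex]]] := kernel_ex e.
have jE z : p (j z).1 = q (j z).2.
  apply/eqP; rewrite -subr_eq0 -(eE (j z)); apply/eqP/jex; by exists z.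
have lj1 : linear (fun z => (j z).1) by move=> a u v; rewrite linearP.
have lj2 : linear (fun z => (j z).2) by move=> a u v; rewrite linearP.
have [j1 j1E] := linear_ex lj1; have [j2 j2E] := linear_ex lj2.
have lk : linear (fun u : U => (0, i u) : P * Q).
  by move=> a u v; rewrite linearP; congr pair; rewrite /= scaler0 addr0.
have lk' : linear (fun u : U' => (i' u, 0) : P * Q).
  by move=> a u v; rewrite linearP; congr pair; rewrite /= scaler0 addr0.
have [k kE] := linear_ex lk; have [k' k'E] := linear_ex lk'.
have [f fE] : exists f : {linear U -> E}, forall u, j (f u) = k u.
  apply: linear_factor => // u; apply/jex; rewrite eE kE /= linear0 sub0r.
  by apply/eqP; rewrite oppr_eq0; apply/eqP/ex; exists u.
have [f' f'E] : exists f : {linear U' -> E}, forall u, j (f u) = k' u.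
  apply: linear_factor => // u; apply/jex; rewrite eE k'E /= linear0 subr0.
  by apply/ex'; exists u.
have s1 : short_exact f j1.
  split=> [u v h|w|z].
  - by have := congr1 j h; rewrite !fE !kE => -[] /ii.
  - have [w' w'E] := qs (p w).
    have /jex[z zE] : e (w, w') = 0 by rewrite eE /= w'E subrr.
    by exists z; rewrite j1E zE.
  - rewrite j1E; split=> [h|[u <-]]; last by rewrite fE kE.
    have /ex[u uE] : q (j z).2 = 0 by rewrite -jE h linear0.
    by exists u; apply: jinj; rewrite fE kE uE -h; case: (j z).
have s2 : short_exact f' j2.
  split=> [u v h|w|z].
  - by have := congr1 j h; rewrite !f'E !k'E => -[] /ii'.
  - have [w' w'E] := ps (q w).
    have /jex[z zE] : e (w', w) = 0 by rewrite eE /= w'E subrr.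
    by exists z; rewrite j2E zE.
  - rewrite j2E; split=> [h|[u <-]]; last by rewrite f'E k'E.
    have /ex'[u uE] : p (j z).1 = 0 by rewrite jE h linear0.
    by exists u; apply: jinj; rewrite f'E k'E uE -h; case: (j z).
(* Both [U * P] and [U' * Q] are isomorphic to the pullback [E], and the bound for [U'] is known. *)
apply: (projdim_le_cancel hP).
apply: (projdim_le_iso (mod_iso_sym (split_short_exact s1 hP))).
apply: (projdim_le_iso (split_short_exact s2 hQ)).
exact: projdim_le_prod.
Qed.

End ProjectiveDimension.

Lemma pd_le_cons (S : pzRingType) m (U P W : lmodType S)
    (i : {linear U -> P}) (q : {linear P -> W}) (Res : proj_resolution U) :
  short_exact i q -> projective P ->
  (forall j, (m <= j)%N -> forall p : Res j, p = 0) -> pd_le W m.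
Proof.
move=> [ii qs ex] hP vR.
pose M j := if j is j'.+1 then Res j' else P.
have ld0 : linear (i \o res_aug Res) by move=> a u v; rewrite /= !linearP.
have [d0 d0E] := linear_ex ld0.
pose d j : {linear M j.+1 -> M j} := if j is j'.+1 then res_d Res j' else d0.
have pM j : projective (M j) by case: j => // j; apply: res_projective.
have ex0 p : q p = 0 <-> exists r, d 0%N r = p.
  rewrite ex; split=> [[u <-]|[r <-]]; last first.
    by exists (res_aug Res r); rewrite /= d0E.
  by have [r <-] := res_aug_surj Res u; exists r; rewrite /= d0E.
have exS j p : d j p = 0 <-> exists r, d j.+1 r = p.
  case: j p => [|j] p; last exact: res_exactS.
  have eR : d 0%N p = i (res_aug Res p) by rewrite -[RHS]d0E.
  have h : d 0%N p = 0 <-> res_aug Res p = 0.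
    by rewrite eR; split=> [e|->]; [apply: ii; rewrite e|]; rewrite linear0.
  by apply: (iff_trans h); exact: res_exact0.
by exists (ProjResolution pM qs ex0 exS) => -[|j] // /vR.
Qed.

Lemma zero_resolution (S : pzRingType) (Z : lmodType S) :
  (forall z : Z, z = 0) ->
  exists Res : proj_resolution Z, forall j (p : Res j), p = 0.
Proof.
move=> Z0.
have l : linear (@id Z) by [].
have [f fE] := linear_ex l.
have pZ (i : nat) : projective Z.
  move=> M N g k _.
  have l0 : linear (fun _ : Z => 0 : M) by move=> a u v; rewrite scaler0 addr0.
  have [h hE] := linear_ex l0.
  by exists h => p; rewrite hE (Z0 p) !linear0.
have fs y : exists p, f p = y by exists y; rewrite fE.
have ex (p : Z) : f p = 0 <-> exists q, f q = p.
  by split=> _; [exists p; rewrite fE | rewrite (Z0 p) linear0].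
by exists (@ProjResolution _ Z (fun=> Z) (fun=> f) f pZ fs ex (fun=> ex)).
Qed.

(** In one direction the kernel of the augmentation is resolved by the same complex shifted by one;
    in the other, presentations are spliced by [pd_le_cons]. *)
Lemma projdim_leP (S : pzRingType) m (W : lmodType S) :
  pd_le W m <-> projdim_le m W.
Proof.
split.
  elim: m W => [|m IH] W [P vP].
    apply: (@projective_iso _ (P 0%N)); last exact: res_projective.
    apply: (surj_inj_iso (f := res_aug P)) (res_aug_surj P) => u v /eqP.
    rewrite -subr_eq0 -linearB => /eqP/res_exact0[w].
    rewrite (vP 1%N isT w) linear0 => /esym/eqP.
    by rewrite subr_eq0 => /eqP.
  have [U [i [ii ex]]] := kernel_ex (res_aug P).
  have ex0 q : exists u, i u = res_d P 0 q.
    by apply/ex/res_exact0; exists q.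
  have [aug augE] := linear_factor ii ex0.
  exists U, (P 0%N), i, (res_aug P); split=> //.
  - exact: res_projective.
  - by split=> //; exact: res_aug_surj.
  apply: IH.
  have aug_surj y : exists p, aug p = y.
    have /ex/res_exact0[q qE] : exists u, i u = i y by exists y.
    by exists q; apply: ii; rewrite augE.
  have aug_ex p : aug p = 0 <-> exists q, res_d P 1 q = p.
    rewrite -res_exactS -augE; split=> [->|e]; first exact: linear0.
    by apply: ii; rewrite e linear0.
  exists (ProjResolution (fun i => @res_projective _ _ P i.+1) aug_surj aug_ex
    (fun i => @res_exactS _ _ P i.+1)) => j jm p.
  exact: (vP j.+1).
elim: m W => [|m IH] W.
  move=> hW.
  have l : linear (@id W) by [].
  have [f fE] := linear_ex l.
  have [Z [i [ii ex]]] := kernel_ex f.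
  have Z0 (z : Z) : z = 0.
    have /ex : exists u, i u = i z by exists z.
    by rewrite fE => e; apply: ii; rewrite e linear0.
  have [Res vR] := zero_resolution Z0.
  apply: (@pd_le_cons _ _ _ _ _ i f Res) => [|//|j _ p]; last exact: vR.
  by split=> // w; exists w; rewrite fE.
move=> [U [T [i [q [hT hs /IH[P vP]]]]]].
exact: (pd_le_cons hs hT vP).
Qed.

(* A projective resolution of the zero module is contractible. *)
Lemma Ext_zero_module (S : pzRingType) (M : lmodType S)
    (P : proj_resolution M) :
  (forall y : M, y = 0) -> forall i (u : Ext P i), u = 0.
Proof.
move=> M0.
have dd i p : res_d P i (res_d P i.+1 p) = 0 by apply/res_exactS; exists p.
(* The homotopy is only asked to satisfy [d s d = d]. Then [id - s d] lands in the kernel of [d],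
   which is the image of the next differential, and it lifts because [P i.+1] is projective. *)
have step i (s : {linear P i -> P i.+1}) :
    (forall q, res_d P i (s (res_d P i q)) = res_d P i q) ->
    exists s' : {linear P i.+1 -> P i.+2},
      forall p, res_d P i.+1 (s' p) = p - s (res_d P i p).
  move=> hs.
  have lt : linear (fun p => p - s (res_d P i p)).
    by move=> a u v; rewrite !linearP addrACA -scalerDr.
  have [t tE] := linear_ex lt.
  have [U [j [jinj jex]]] := kernel_ex (res_d P i).
  have [k kE] : exists k : {linear P i.+1 -> U}, forall p, j (k p) = t p.
    by apply: linear_factor => // p; apply/jex; rewrite tE linearB hs subrr.
  have [g gE] :
      exists g : {linear P i.+2 -> U}, forall p, j (g p) = res_d P i.+1 p.
    by apply: linear_factor => // p; apply/jex; rewrite dd.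
  have gs y : exists p, g p = y.
    have /jex/res_exactS[p pE] : exists u, j u = j y by exists y.
    by exists p; apply: jinj; rewrite gE.
  have [h hE] := @res_projective _ _ P i.+1 _ _ g k gs.
  by exists h => p; rewrite -gE hE kE tE.
have contraction i : exists s : {linear P i -> P i.+1},
    forall q, res_d P i (s (res_d P i q)) = res_d P i q.
  elim: i => [|i [s /step[s' s'E]]]; last first.
    by exists s' => q; rewrite s'E dd linear0 subr0.
  have l : linear (@id (P 0%N)) by [].
  have [k kE] := linear_ex l.
  have ds y : exists p, res_d P 0 p = y by apply/res_exact0/M0.
  have [h hE] := @res_projective _ _ P 0 _ _ _ k ds.
  by exists h => q; rewrite hE kE.
(* In positive degree [p = d (s' p) + s (d p)]; a cocycle [f] kills the first term, so it is the
   coboundary of [f \o s]. *)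
have cob i (f : P i -> S) : is_cocycle f -> is_coboundary f.
  case: i f => [|i] f [lf f0].
    move=> p /=; have [q <-] : exists q, res_d P 0 q = p.
      exact/res_exact0/M0.
    exact: f0.
  have [s /step[s' s'E]] := contraction i.
  exists (f \o s) => [a u v|p]; first by rewrite /= linearP lf.
  have e : p = 1 *: res_d P i.+1 (s' p) + s (res_d P i p).
    by rewrite scale1r s'E subrK.
  by rewrite {1}e lf f0 scaler0 add0r.
move=> i u; have [f ->] := pi_quotmod_surj u.
rewrite -(pi_quotmod0 (@coboundary S M P i)).
apply/pi_quotmodE; rewrite subr0; apply/asboolP/cob.
by apply/asboolP; exact: (submodule_valP f).
Qed.

(** * Free modules *)

Section RestrictionOfScalars.
Variables (R A : pzRingType) (iota : {rmorphism R -> A}) (N : lmodType A).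

(** The morphism stays visible in the type, so that the scaling through [iota] can be inferred from
    it although the carrier is [N]. *)
Definition restr_scalars of {rmorphism R -> A} : Type := N.
Local Notation M := (restr_scalars iota).

HB.instance Definition _ := GRing.Zmodule.on M.

Definition restr_scale (r : R) (u : M) : M := iota r *: (u : N).

Fact restr_scaleA a b (u : M) :
  restr_scale a (restr_scale b u) = restr_scale (a * b) u.
Proof. by rewrite /restr_scale scalerA rmorphM. Qed.

Fact restr_scale1 : left_id 1 restr_scale.
Proof. by move=> u; rewrite /restr_scale rmorph1 scale1r. Qed.

Fact restr_scaleDr : right_distributive restr_scale +%R.
Proof. by move=> a u v; rewrite /restr_scale scalerDr. Qed.

Fact restr_scaleDl (u : M) : {morph restr_scale^~ u : a b / a + b}.
Proof. by move=> a b; rewrite /restr_scale rmorphD scalerDl. Qed.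

HB.instance Definition _ := GRing.Zmodule_isLmodule.Build R M
  restr_scaleA restr_scale1 restr_scaleDr restr_scaleDl.

Lemma restr_scaleE (r : R) (u : N) : r *: (u : M) = iota r *: u :> N.
Proof. by []. Qed.

End RestrictionOfScalars.

Lemma eq_big_support (T : eqType) (V : nmodType) (F : T -> V) (s1 s2 : seq T) :
  uniq s1 -> uniq s2 -> (forall t, t \notin s1 -> F t = 0) ->
  (forall t, t \notin s2 -> F t = 0) ->
  \sum_(t <- s1) F t = \sum_(t <- s2) F t.
Proof.
move=> u1 u2 h1 h2.
have red s : \sum_(t <- s) F t = \sum_(t <- s | F t != 0) F t.
  rewrite [LHS](bigID (fun t => F t != 0)) /= [X in _ + X]big1 ?addr0 // => t.
  by rewrite negbK => /eqP.
rewrite (red s1) (red s2) -!(big_filter _ (fun t => F t != 0)).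
apply/perm_big/uniq_perm; rewrite ?filter_uniq // => t.
rewrite !mem_filter; case: eqP => //= Ft.
by rewrite (contra_notT (h1 t)) // (contra_notT (h2 t)).
Qed.

(** Freeness of [L] on [G], encoded as an identification with the finitely supported functions
    [G -> S] rather than by a basis: filtrations and ideals can then be computed coordinate by
    coordinate. *)
Record coordinates (S : pzRingType) (G : eqType) (L : lmodType S)
    (coord : L -> G -> S) : Prop := Coordinates {
  coordP : forall a u v g, coord (a *: u + v) g = a * coord u g + coord v g;
  coord_inj : forall u v, coord u =1 coord v -> u = v;
  coord_fin : forall u,
    exists2 s, uniq s & forall g, g \notin s -> coord u g = 0;
  coord_onto : forall (f : G -> S) (s : seq G),
    (forall g, g \notin s -> f g = 0) -> exists u, coord u =1 f }.

Lemma free_module_ex (S : pzRingType) (G : choiceType) :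
  exists (L : lmodType S) (coord : L -> G -> S), coordinates coord.
Proof.
have [] := @submodule_ex S (G -> S^o)
  (fun u => exists s : seq G, forall g, g \notin s -> u g = 0).
- by exists [::].
- move=> a u v [s hs] [t ht]; exists (s ++ t) => g.
  rewrite mem_cat negb_or => /andP[/hs us /ht vt].
  by rewrite -[LHS]/(a * u g + v g) us vt mulr0 addr0.
move=> L [i [ii iE]]; exists L, i; split.
- by move=> a u v g; rewrite linearP.
- by move=> u v e; apply: ii; apply/funext.
- move=> u; have [s hs] : exists s : seq G, forall g, g \notin s -> i u g = 0.
    by apply/iE; exists u.
  exists (undup s) => [|g]; first exact: undup_uniq.
  by rewrite mem_undup => /hs.
- move=> f s hs.
  have /iE[u uE] : exists s : seq G, forall g, g \notin s -> f g = 0.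
    by exists s.
  by exists u => g; rewrite uE.
Qed.

Section Coordinates.
Variables (S : pzRingType) (G : eqType) (L : lmodType S) (coord : L -> G -> S).
Hypothesis coordL : coordinates coord.

Lemma coordD u v g : coord (u + v) g = coord u g + coord v g.
Proof. by rewrite -[u]scale1r (coordP coordL) mul1r scale1r. Qed.

Lemma coord0 g : coord 0 g = 0.
Proof.
by apply: (addrI (coord 0 g)); rewrite -coordD !addr0.
Qed.

Lemma coordZ a u g : coord (a *: u) g = a * coord u g.
Proof. by rewrite -[_ *: _]addr0 (coordP coordL) coord0 addr0. Qed.

Lemma coordB u v g : coord (u - v) g = coord u g - coord v g.
Proof. by rewrite coordD -scaleN1r coordZ mulN1r. Qed.

Lemma coord_sum I (s : seq I) (F : I -> L) g :
  coord (\sum_(i <- s) F i) g = \sum_(i <- s) coord (F i) g.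
Proof.
by elim/big_rec2: _ => [|i y z _ e]; rewrite ?coord0 // coordD e.
Qed.

Lemma basis_ex : exists e : G -> L, forall g h, coord (e g) h = (g == h)%:R.
Proof.
have /choice[e eE] : forall g, exists e, coord e =1 (fun h => (g == h)%:R).
  move=> g; apply: (coord_onto coordL (s := [:: g])) => h.
  by rewrite inE eq_sym => /negPf ->.
by exists e.
Qed.

Lemma coord_expand (e : G -> L) (s : seq G) u :
  (forall g h, coord (e g) h = (g == h)%:R) ->
  uniq s -> (forall g, g \notin s -> coord u g = 0) ->
  u = \sum_(g <- s) coord u g *: e g.
Proof.
move=> eE us hs; apply: (coord_inj coordL) => h; rewrite coord_sum.
under eq_bigr => g _ do rewrite coordZ eE.
have [hin|hout] := boolP (h \in s); last first.
  rewrite hs // big_seq big1 // => g gs.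
  by rewrite (_ : g == h = false) ?mulr0 //; apply: contraNF hout => /eqP <-.
rewrite (bigD1_seq h) //= eqxx mulr1 big1 ?addr0 // => g /negPf ->.
by rewrite mulr0.
Qed.

(** The formula is given for every duplicate-free list containing the support, because linearity
    compares [u], [v] and [a *: u + v] on a common list. *)
Lemma coord_lift (V : lmodType S) (phi : G -> V) :
  exists f : {linear L -> V}, forall u s,
    uniq s -> (forall g, g \notin s -> coord u g = 0) ->
    f u = \sum_(g <- s) coord u g *: phi g.
Proof.
have sup u : {s : seq G | uniq s /\ forall g, g \notin s -> coord u g = 0}.
  by apply/cid; have [s su h] := coord_fin coordL u; exists s.
pose f u := \sum_(g <- sval (sup u)) coord u g *: phi g.
have fE u s : uniq s -> (forall g, g \notin s -> coord u g = 0) ->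
    f u = \sum_(g <- s) coord u g *: phi g.
  move=> us hs; rewrite /f; case: (sup u) => /= t [ut ht].
  by apply: eq_big_support => // g => [/ht|/hs] ->; rewrite scale0r.
have lf : linear f.
  move=> a u v; case: (sup u) (sup v) => [s [us hs]] [t [ut ht]].
  pose w := undup (s ++ t).
  have hu g : g \notin w -> coord u g = 0.
    by rewrite mem_undup mem_cat negb_or => /andP[/hs].
  have hv g : g \notin w -> coord v g = 0.
    by rewrite mem_undup mem_cat negb_or => /andP[_ /ht].
  have uw : uniq w by apply: undup_uniq.
  rewrite !(fE _ w) // => [|g gw]; last first.
    by rewrite (coordP coordL) hu // hv // mulr0 addr0.
  rewrite scaler_sumr -big_split /=; apply: eq_bigr => g _.
  by rewrite (coordP coordL) scalerDl scalerA.
have [f' f'E] := linear_ex lf.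
by exists f' => u s us hs; rewrite f'E; apply: fE.
Qed.

Lemma free_projective : projective L.
Proof.
move=> M N g f gs.
have [e eE] := basis_ex.
have /choice[m mE] : forall t, exists x, g x = f (e t) by move=> t; apply: gs.
have [h hE] := coord_lift m.
exists h => u; have [s us hs] := coord_fin coordL u.
rewrite (hE _ _ us hs) linear_sum [in RHS](coord_expand eE us hs) linear_sum.
by apply: eq_bigr => t _; rewrite !linearZ /= mE.
Qed.

End Coordinates.

(** * Reflection for abelian groups *)

Inductive zexpr := ZVar of nat | ZAdd of zexpr & zexpr | ZOpp of zexpr | ZZero.

Fixpoint zeval (V : zmodType) (env : seq V) (e : zexpr) : V :=
  match e with
  | ZVar i => env`_i
  | ZAdd a b => zeval env a + zeval env b
  | ZOpp a => - zeval env a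
  | ZZero => 0
  end.

Fixpoint zcoef (e : zexpr) (i : nat) : int :=
  match e with
  | ZVar j => if i == j then 1 else 0
  | ZAdd a b => zcoef a i + zcoef b i
  | ZOpp a => - zcoef a i
  | ZZero => 0
  end.

Lemma zevalE (V : zmodType) (env : seq V) e :
  zeval env e = \sum_(i < size env) env`_i *~ zcoef e i.
Proof.
elim: e => [j|a ha b hb|a ha|] /=; last by rewrite big1.
(* A variable past the end of [env] reads the default value 0, and its coefficient is 0 at every
   index of the sum. *)
- have [jlt|jge] := ltnP j (size env); last first.
    rewrite nth_default // big1 // => i _.
    by case: eqP => // e; move: jge; rewrite -e leqNgt ltn_ord.
  rewrite (bigD1 (Ordinal jlt)) //= eqxx mulr1z big1 ?addr0 // => i.
  by rewrite -val_eqE /= => /negPf ->.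
- by rewrite ha hb -big_split; apply: eq_bigr => i _; rewrite mulrzDr.
- by rewrite ha -sumrN; apply: eq_bigr => i _; rewrite mulrNz.
Qed.

Lemma zeval_eq (V : zmodType) (env : seq V) e1 e2 :
  all (fun i => zcoef e1 i == zcoef e2 i) (iota 0 (size env)) ->
  zeval env e1 = zeval env e2.
Proof.
move=> /allP h; rewrite !zevalE; apply: eq_bigr => i _.
by have /eqP -> : zcoef e1 i == zcoef e2 i by apply: h; rewrite mem_iota ltn_ord.
Qed.

Ltac zindex a env :=
  lazymatch env with
  | a :: _ => constr:(0%N)
  | _ :: ?l => let i := zindex a l in constr:(S i)
  end.

Ltac zatoms e env :=
  lazymatch e with
  | (?a + ?b)%R => let l := zatoms a env in zatoms b l
  | (- ?a)%R => zatoms a env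
  | (0)%R => env
  (* The match on a dummy term serves for its backtracking: when [zindex] fails, the atom is new and
     is added. *)
  | ?a => match constr:(Set) with
          | _ => let i := zindex a env in env
          | _ => constr:(a :: env)
          end
  end.

Ltac zreify e env :=
  lazymatch e with
  | (?a + ?b)%R =>
      let x := zreify a env in let y := zreify b env in constr:(ZAdd x y)
  | (- ?a)%R => let x := zreify a env in constr:(ZOpp x)
  | (0)%R => constr:(ZZero)
  | ?a => let i := zindex a env in constr:(ZVar i)
  end.

(* Decides identities of abelian groups. *)
Ltac zmod :=
  lazymatch goal with
  | |- @eq ?T ?a ?b =>
      let env0 := constr:(@nil T) in
      let env1 := zatoms a env0 in
      let env := zatoms b env1 in
      let x := zreify a env in
      let y := zreify b env in
      refine (@zeval_eq _ env x y _); vm_compute; reflexivity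
  end.

(** * Filtered modules and regular sequences *)

Section FilteredModules.
Variables (R A : pzRingType) (iota : {rmorphism R -> A}).
Variables (n : nat) (X : nat -> A).

(** The properties of a bijective skew PBW extension behind the dimension argument: modulo lower
    degree each [X i] is normal, and [A] is generated by [R] and the variables. The last field puts
    generation as an induction principle. *)
Record normal_generators : Prop := NormalGenerators {
  ng_right : forall i r, exists r1 r2, iota r * X i = X i * iota r1 + iota r2;
  ng_swap : forall i j, (i < n)%N -> (j < n)%N -> exists c (a : nat -> R) d,
    X j * X i = iota c * (X i * X j) + \sum_(k < n) iota (a k) * X k + iota d;
  ng_gen : forall D : A -> Prop, D 1 ->
    (forall u v, D u -> D v -> D (u + v)) ->
    (forall r u, D u -> D (iota r * u)) ->
    (forall i u, (i < n)%N -> D u -> D (X i * u)) -> forall a, D a }.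

Hypothesis hX : normal_generators.

Definition Rsubmod (N : lmodType A) (P : N -> Prop) : Prop :=
  P 0 /\ forall r u v, P u -> P v -> P (iota r *: u + v).

Lemma RsubmodD (N : lmodType A) (P : N -> Prop) u v :
  Rsubmod P -> P u -> P v -> P (u + v).
Proof.
by move=> [_ h] hu hv; rewrite -[u]scale1r -(rmorph1 iota); apply: h.
Qed.

Lemma RsubmodZ (N : lmodType A) (P : N -> Prop) r u :
  Rsubmod P -> P u -> P (iota r *: u).
Proof. by move=> [h0 h] hu; rewrite -[_ *: u]addr0; apply: h. Qed.

Lemma RsubmodN (N : lmodType A) (P : N -> Prop) u :
  Rsubmod P -> P u -> P (- u).
Proof.
by move=> h hu; rewrite -scaleN1r -(rmorph1 iota) -rmorphN; apply: RsubmodZ.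
Qed.

Lemma RsubmodB (N : lmodType A) (P : N -> Prop) u v :
  Rsubmod P -> P u -> P v -> P (u - v).
Proof. by move=> h hu hv; apply: RsubmodD => //; apply: RsubmodN. Qed.

Lemma Rsubmod_sum (N : lmodType A) (P : N -> Prop) I (s : seq I) (F : I -> N) :
  Rsubmod P -> (forall i, P (F i)) -> P (\sum_(i <- s) F i).
Proof.
move=> h hF; elim/big_rec: _ => [|i u _ hu]; first by case: h.
exact: RsubmodD.
Qed.

Lemma Rsubmod_stable (N : lmodType A) (P : N -> Prop) a u :
  Rsubmod P -> (forall i u, (i < n)%N -> P u -> P (X i *: u)) ->
  P u -> P (a *: u).
Proof.
move=> hP PX hu; move: a; apply: (ng_gen hX) => [|a b ha hb|r a ha|i a ilt ha].
- by rewrite scale1r.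
- by rewrite scalerDl; apply: RsubmodD.
- by rewrite -scalerA; apply: RsubmodZ.
- by rewrite -scalerA; apply: PX.
Qed.

(* [F k] is the part of degree [< k], so that [F 0 = 0]. *)
Record filtration (N : lmodType A) (F : nat -> N -> Prop) : Prop := Filtration {
  filt0 : forall u, F 0%N u -> u = 0;
  filt_submod : forall k, Rsubmod (F k);
  filtS : forall k u, F k u -> F k.+1 u;
  filtX : forall k i u, (i < n)%N -> F k u -> F k.+1 (X i *: u) }.

(* [P + X 0 P + ... + X (i - 1) P] *)
Fixpoint ideal_part (N : lmodType A) (P : N -> Prop) (i : nat) (u : N) : Prop :=
  match i with
  | 0 => P u
  | i'.+1 => exists2 w, P w & ideal_part P i' (u - X i' *: w)
  end.

(* The classes of [X 0, ..., X (j - 1)] form a regular sequence on the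
   associated graded module. *)
Definition regular (N : lmodType A) (F : nat -> N -> Prop) (j : nat) : Prop :=
  forall i k u, (i < j)%N -> F k.+1 u ->
    ideal_part (F k.+1) i (X i *: u) -> ideal_part (F k) i u.

Lemma ideal_part_incl (N : lmodType A) (P : N -> Prop) i u :
  Rsubmod P -> P u -> ideal_part P i u.
Proof.
move=> hP; elim: i u => //= i IH u hu.
by exists 0; [case: hP | rewrite scaler0 subr0; apply: IH].
Qed.

Lemma ideal_part_leq (N : lmodType A) (P : N -> Prop) i j u :
  Rsubmod P -> (i <= j)%N -> ideal_part P i u -> ideal_part P j u.
Proof.
move=> hP; elim: j => [|j IH]; first by rewrite leqn0 => /eqP ->.
rewrite leq_eqVlt => /orP[/eqP -> //|ij] hu.
by exists 0; [case: hP | rewrite scaler0 subr0; apply: IH].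
Qed.

(** A scalar is moved past [X i] by [ng_right]; the error term [iota r2 *: w] stays in [P], which
    every ideal part contains. *)
Lemma ideal_part_submod (N : lmodType A) (P : N -> Prop) i :
  Rsubmod P -> Rsubmod (ideal_part P i).
Proof.
move=> hP; split; first by apply: ideal_part_incl => //; case: hP.
elim: i => [|i IH] r u v /=; first by move: r u v; case: hP.
have hQ : Rsubmod (ideal_part P i).
  by split=> //; apply: ideal_part_incl => //; case: hP.
move=> [w hw uw] [w' hw' vw'].
have [r1 [r2 rE]] := ng_right hX i r.
exists (iota r1 *: w + w'); first by case: hP => _; apply.
have -> : iota r *: u + v - X i *: (iota r1 *: w + w') =
    iota r *: (u - X i *: w) + (v - X i *: w') + iota r2 *: w.
  by rewrite scalerDr scalerBr !scalerA rE scalerDl -!scalerA; zmod.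
apply: RsubmodD => //; first exact: IH.
by apply: ideal_part_incl => //; apply: RsubmodZ.
Qed.

Lemma ideal_part_top (N : lmodType A) (P : N -> Prop) i u :
  Rsubmod P -> P u -> ideal_part P i.+1 (X i *: u).
Proof.
by move=> hP hu; exists u; rewrite // subrr; case: (ideal_part_submod i hP).
Qed.

Lemma ideal_part_sub (N : lmodType A) (P Z : N -> Prop) i u :
  Rsubmod Z -> (forall i u, (i < n)%N -> P u -> Z (X i *: u)) ->
  (forall u, P u -> Z u) -> (i <= n)%N -> ideal_part P i u -> Z u.
Proof.
move=> hZ XZ PZ; elim: i u => [|i IH] u ilt; first exact: PZ.
move=> [w hw hu]; rewrite -[u](subrK (X i *: w)).
by apply: RsubmodD; [|apply: IH => //; apply: ltnW|apply: XZ].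
Qed.

Lemma ideal_part_map (N N' : lmodType A) (f : {linear N -> N'})
    (P : N -> Prop) (P' : N' -> Prop) i u :
  (forall u, P u -> P' (f u)) -> ideal_part P i u -> ideal_part P' i (f u).
Proof.
move=> hf; elim: i u => [|i IH] u; first exact: hf.
move=> [w hw /IH]; rewrite linearB linearZ => h.
by exists (f w) => //; apply: hf.
Qed.

Lemma ideal_part_lift (N N' : lmodType A) (f : {linear N -> N'})
    (P : N -> Prop) (P' : N' -> Prop) i v :
  Rsubmod P -> (forall v, P' v -> exists2 u, P u & f u = v) ->
  ideal_part P' i v -> exists2 u, ideal_part P i u & f u = v.
Proof.
move=> hP hf; elim: i v => [|i IH] v; first exact: hf.
move=> [w /hf[w' hw' <-] /IH[u hu fu]].
exists (u + X i *: w'); last by rewrite linearD linearZ fu subrK.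
by exists w'; rewrite // addrK.
Qed.

(** Normality of [X i] in the graded sense: after exchanging the variables, the coefficient [c] in
    front of [X i] is moved to its right, and everything else has lower degree. *)
Lemma filtXX (N : lmodType A) (F : nat -> N -> Prop) k i j u : filtration F ->
  (i < n)%N -> (j < n)%N -> F k u -> exists2 w, F k.+1 w &
    F k.+1 (X j *: (X i *: u) - X i *: w).
Proof.
move=> hF ilt jlt hu.
have [c [a [d e]]] := ng_swap hX ilt jlt.
have [r1 [r2 rE]] := ng_right hX i c.
have hk := filt_submod hF.
exists (iota r1 *: (X j *: u)).
  by apply: RsubmodZ => //; apply: (filtX hF).
have -> : X j *: (X i *: u) - X i *: (iota r1 *: (X j *: u)) =
    iota r2 *: (X j *: u) + \sum_(k < n) iota (a k) *: (X k *: u) + iota d *: u.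
  have -> : \sum_(k < n) iota (a k) *: (X k *: u) =
      (\sum_(k < n) iota (a k) * X k) *: u.
    by rewrite scaler_suml; apply: eq_bigr => k0 _; rewrite scalerA.
  rewrite !scalerA e (mulrA (iota c)) rE !mulrDl !scalerDl.
  by zmod.
apply: RsubmodD => //; first apply: RsubmodD => //.
- by apply: RsubmodZ => //; apply: (filtX hF).
- by apply: Rsubmod_sum => // i'; apply: RsubmodZ => //; apply: (filtX hF).
- by apply: (filtS hF); apply: RsubmodZ.
Qed.

(** By normality, the graded submodule generated by the first [i] variables is stable under all
    variables. *)
Lemma ideal_partX (N : lmodType A) (F : nat -> N -> Prop) k i m u :
  filtration F -> (i <= n)%N -> (m < n)%N -> ideal_part (F k) i u ->
  ideal_part (F k.+1) i (X m *: u).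
Proof.
move=> hF; elim: i u => [|i IH] u ilt mlt; first exact: (filtX hF).
move=> [w hw /(IH _ (ltnW ilt) mlt)]; rewrite scalerBr => hu.
have [w' hw' h] := filtXX hF ilt mlt hw.
have hk := filt_submod hF.
exists w' => //.
have -> : X m *: u - X i *: w' = (X m *: u - X m *: (X i *: w)) +
    (X m *: (X i *: w) - X i *: w') by zmod.
apply: RsubmodD => //; first exact: ideal_part_submod.
exact: ideal_part_incl.
Qed.

(** So [ideal_part (F k) i] is the preimage in [F k.+1] of the degree [k] piece of the submodule
    [(X 0, ..., X (i - 1)) gr N]. *)
Lemma ideal_part_filtS (N : lmodType A) (F : nat -> N -> Prop) k i u :
  filtration F -> (i <= n)%N -> ideal_part (F k) i u -> F k.+1 u.
Proof.
move=> hF; apply: ideal_part_sub => //; first exact: (filt_submod hF).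
- by move=> j v jn; apply: (filtX hF).
- exact: (filtS hF).
Qed.

Lemma ideal_part0 (N : lmodType A) (F : nat -> N -> Prop) i u : filtration F ->
  ideal_part (F 0%N) i u -> u = 0.
Proof.
move=> hF; elim: i u => [|i IH] u; first exact: (filt0 hF).
by move=> [w /(filt0 hF) -> /IH]; rewrite scaler0 subr0.
Qed.

Section Depth.
Variables (U L N : lmodType A) (i : {linear U -> L}) (q : {linear L -> N}).
Variables (FL : nat -> L -> Prop) (FN : nat -> N -> Prop).
Hypotheses (hs : short_exact i q) (hL : filtration FL) (hN : filtration FN).
Hypothesis q_filt : forall k u, FL k u -> FN k (q u).
Hypothesis q_onto : forall k v, FN k v -> exists2 u, FL k u & q u = v.

Let FU k u := FL k (i u).

Lemma kernel_filtration : filtration FU.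
Proof.
have [ii _ _] := hs; split=> [u|k|k u|k j u]; rewrite /FU.
- by move=> /(filt0 hL) e; apply: ii; rewrite e linear0.
- have [h0 hP] := filt_submod hL k.
  by split=> [|r u v hu hv]; rewrite ?linear0 ?linearP //; apply: hP.
- exact: (filtS hL).
- by rewrite linearZ; apply: (filtX hL).
Qed.

(** A vanishing of Tor in elementary form: if the first variables are regular on [gr N], an element
    of [gr U] that lies in [I gr L] already lies in [I gr U], where [I] is generated by these
    variables. *)
Lemma ideal_part_kernel j i' k u : regular FN j -> (i' <= j)%N -> (j <= n)%N ->
  ideal_part (FL k) i' (i u) -> ideal_part (FU k) i' u.
Proof.
move=> reg; have hU := kernel_filtration; have [ii qs ex] := hs.
have qi v : q (i v) = 0 by apply/ex; exists v.
move=> ij jn; elim: i' ij k u => [|i' IH] ij k u //.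
have IH' := IH (ltnW ij) => -[w hw hu].
have i'n : (i' < n)%N by apply: leq_trans jn.
have {}hqw : ideal_part (FN k) i' (X i' *: q w).
  have /(ideal_part_map (q_filt (k := k))) := hu.
  rewrite linearB linearZ qi sub0r /=.
  move=> /(RsubmodN (ideal_part_submod i' (filt_submod hN k))).
  by rewrite opprK.
(* Regularity speaks only of [F k.+1]; for [k = 0] the coefficient [w] is itself 0. *)
case: k hw hu hqw => [|k] hw hu hqw.
  move: hu; rewrite (filt0 hL hw) scaler0 subr0 => /IH' h.
  by apply: ideal_part_leq h => //; exact: (filt_submod hU).
(* Regularity makes [q w] a combination of earlier variables in lower degree. Subtracting a lift
   [w'] of it turns the coefficient [w] into an element of [U]. *)
have /(ideal_part_lift (filt_submod hL k) (q_onto (k := k)))[w' hw' qw'] :=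
  reg i' k (q w) ij (q_filt hw) hqw.
have /ex[t tE] : q (w - w') = 0 by rewrite linearB qw' subrr.
exists t.
  rewrite /FU tE; apply: RsubmodB => //; first exact: (filt_submod hL).
  by apply: ideal_part_filtS hw' => //; apply: ltnW.
apply: IH'; rewrite linearB linearZ /= tE scalerBr.
have -> : i u - (X i' *: w - X i' *: w') = (i u - X i' *: w) + X i' *: w'.
  by zmod.
apply: RsubmodD => //; first exact: ideal_part_submod (filt_submod hL _).
by apply: ideal_partX => //; apply: ltnW.
Qed.

(** The kernel gains one variable: cancelling [X i'] takes place in [L], and pulling the result back
    to [U] uses only the [i'] earlier variables on [N], so [i' = j] is allowed. *)
Lemma kernel_regular j m : (j <= n)%N -> (m <= n)%N -> (m <= j.+1)%N ->
  regular FL n -> regular FN j -> regular FU m.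
Proof.
move=> jn mn mj rL rN i' k u im hu hXu.
have ij : (i' <= j)%N by rewrite -ltnS; apply: leq_trans im mj.
apply: (ideal_part_kernel rN) => //.
apply: rL => //; first exact: leq_trans mn.
by rewrite -linearZ; apply: ideal_part_map hXu.
Qed.

End Depth.

End FilteredModules.

(** * Projectivity from regular filtrations *)

Lemma dependent_choice (I : Type) (T : I -> Type) (P : forall i, T i -> Prop) :
  (forall i, exists y, P i y) -> exists f, forall i, P i (f i).
Proof. by move=> h; exists (fun i => sval (cid (h i))) => i; case: cid. Qed.

Section RegularFiltrations.
Variables (R A : pzRingType) (iota : {rmorphism R -> A}).
Variables (n : nat) (X : nat -> A).
Hypothesis hX : normal_generators iota n X.

Local Notation Rsubmod := (Rsubmod iota).
Local Notation filtration := (filtration iota n X).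
Local Notation ideal_part := (ideal_part X).

(* [p] induces an isomorphism from the subquotient [P / P'] of [N] to [W]. *)
Record subquotient (N : lmodType A) (P P' : N -> Prop) (W : lmodType R)
    (p : N -> W) : Prop := Subquotient {
  sq_lin : forall r u v, P u -> P v -> p (iota r *: u + v) = r *: p u + p v;
  sq_ker : forall u, P u -> (p u = 0 <-> P' u);
  sq_onto : forall w, exists2 u, P u & p u = w }.

Lemma subquotient_ex (N : lmodType A) (P P' : N -> Prop) :
  Rsubmod P -> Rsubmod P' -> exists (W : lmodType R) (p : N -> W),
    subquotient P P' p.
Proof.
move=> [P0 PP] [P'0 PP'].
have [E [i [ii iE]]] :=
  @submodule_ex R (restr_scalars N iota) P P0 PP.
have [W [q [qs qE]]] : exists (W : lmodType R) (q : {linear E -> W}),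
    (forall w, exists v, q v = w) /\ forall v, q v = 0 <-> P' (i v).
  apply: quotient_ex => [|r u v hu hv]; first by rewrite linear0.
  by rewrite linearP; apply: PP'.
(* Outside [P] the map takes the default value 0. *)
have pE u : {w | P u -> exists2 e, i e = u & q e = w}.
  apply: cid; have [hu|hu] := pselect (P u); last by exists 0.
  by have /iE[e eE] := hu; exists (q e) => _; exists e.
pose p u := sval (pE u).
have pP e : p (i e) = q e.
  rewrite /p; case: (pE (i e)) => w /= h.
  by have [|e' /ii -> //] := h; apply/iE; exists e.
exists W, p; split.
- move=> r u v /iE[e <-] /iE[e' <-].
  by rewrite -[iota r *: _]/(r *: i e) -linearP !pP linearP.
- by move=> u /iE[e <-]; rewrite pP qE.
- move=> w; have [e eE] := qs w.
  by exists (i e); rewrite ?pP //; apply/iE; exists e.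
Qed.

Section Subquotient.
Variables (N : lmodType A) (P P' : N -> Prop) (W : lmodType R) (p : N -> W).
Hypotheses (hP : Rsubmod P) (hp : subquotient P P' p).

Lemma sqB u v : P u -> P v -> p (u - v) = p u - p v.
Proof.
move=> hu hv; have := sq_lin hp (-1) hv hu.
by rewrite rmorphN rmorph1 !scaleN1r addrC => ->; rewrite addrC.
Qed.

Lemma subquotient_section : projective W ->
  exists s : W -> N, [/\ forall r v w, s (r *: v + w) = iota r *: s v + s w,
    forall w, P (s w) & forall w, p (s w) = w].
Proof.
move=> hW; have [P0 PP] := hP.
have [E [i [ii iE]]] :=
  @submodule_ex R (restr_scalars N iota) P P0 PP.
have Pi e : P (i e) by apply/iE; exists e.
have lq : linear (fun e => p (i e)).
  by move=> r u v; rewrite linearP; apply: (sq_lin hp).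
have [q qE] := linear_ex lq.
have qs w : exists e, q e = w.
  by have [u /iE[e <-] <-] := sq_onto hp w; exists e; rewrite qE.
have l : linear (@id W) by [].
have [k kE] := linear_ex l.
have [h hE] := hW _ _ q k qs.
exists (fun w => i (h w)); split=> [r v w|//|w].
  by rewrite !linearP.
by rewrite -qE hE kE.
Qed.

End Subquotient.

(* An element of [N] may be written in many ways as an [A]-combination of
   values of the [s k]; [graph] collects the pairs of such a combination with
   the corresponding one for [t]. Regularity makes it a functional relation. *)
Lemma regular_lift (N M N' : lmodType A) (F : nat -> N -> Prop)
    (g : {linear M -> N'}) (f : {linear N -> N'})
    (W : nat -> lmodType R) (s : forall k, W k -> N) (t : forall k, W k -> M) :
  filtration F -> (forall u, exists k, F k u) -> regular X F n ->
  (forall k r v w, s k (r *: v + w) = iota r *: s k v + s k w) ->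
  (forall k r v w, t k (r *: v + w) = iota r *: t k v + t k w) ->
  (forall k w, F k.+1 (s k w)) ->
  (forall k u, F k.+1 u -> exists w, ideal_part (F k) n (u - s k w)) ->
  (forall k w, ideal_part (F k) n (s k w) -> w = 0) ->
  (forall k w, g (t k w) = f (s k w)) ->
  exists h : {linear N -> M}, forall u, g (h u) = f u.
Proof.
move=> hF exF reg ls lt Fs s_gen s_inj st_lift.
have hFk := filt_submod hF.
pose st k w : N * M := (s k w, t k w).
have stP k r v w : st k (r *: v + w) = iota r *: st k v + st k w.
  by congr pair.
have st0 k : st k 0 = 0.
  have := stP k 1 0 0; rewrite scaler0 addr0 rmorph1 scale1r => e.
  by apply: (addrI (st k 0)); rewrite addr0 -e.
(* [graph k.+1] arises from [graph k] as [F k.+1] does from [F k]: add the new generators [st k w]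
   and the multiples by variables. *)
pose graph := fix graph k : N * M -> Prop :=
  if k is k'.+1 then fun z => exists w : W k',
    ideal_part (graph k') n (z - st k' w)
  else fun z => z = 0.
have hG k : Rsubmod (graph k).
  elim: k => [|k IH] /=.
    by split=> // r u v -> ->; rewrite scaler0 addr0.
  have [I0 IP] := ideal_part_submod hX n IH.
  split=> [|r u v [w hw] [w' hw']]; first by exists 0; rewrite st0 subr0.
  exists (r *: w + w').
  have -> : iota r *: u + v - st k (r *: w + w') =
      iota r *: (u - st k w) + (v - st k w').
    by rewrite stP scalerBr opprD addrACA.
  exact: IP.
have hGfilt : filtration graph.
  split=> [//|//|k z hz|k i z ilt hz] /=; exists 0; rewrite st0 subr0.
    exact: ideal_part_incl.
  apply: (ideal_part_leq (hG k) ilt); exact: (ideal_part_top hX).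
have lfst : linear (fst : N * M -> N) by [].
have [pr prE] := linear_ex lfst.
have graph_filt k z : graph k z -> F k (pr z).
  elim: k z => [|k IH] z /=.
    by move=> ->; rewrite linear0; case: (hFk 0%N).
  move=> [w /(ideal_part_map IH)]; rewrite linearB (prE (st k w)) /= => hw.
  rewrite -[pr z](subrK (s k w)); apply: (RsubmodD (hFk _)); last exact: Fs.
  exact: (ideal_part_filtS hF _ hw).
have graph_onto k u : F k u -> exists2 z, graph k z & pr z = u.
  elim: k u => [|k IH] u hu.
    by exists 0; rewrite ?linear0 // (filt0 hF hu).
  have [w hw] := s_gen k u hu.
  have [z hz zE] := ideal_part_lift (hG k) IH hw.
  exists (z + st k w); first by exists w; rewrite addrK.
  by rewrite linearD zE (prE (st k w)) /= subrK.
have graph_inj k z : graph k z -> pr z = 0 -> z = 0.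
  elim: k z => [|k IHk] // z [w hw] z0.
  (* A pair whose first component has degree lower than expected is itself in the lower step. By
     regularity each coefficient [v] has the same first component as some [v'] of lower degree;
     injectivity at the previous step gives [v = v'], so [X i *: v] can be absorbed by the earlier
     variables. *)
  have strict i y : (i <= n)%N -> ideal_part (graph k) i y -> F k (pr y) ->
      graph k y.
    elim: i y => [|i IHi] // y ilt hy Fy.
    case: k {z w hw z0} IHk IHi hy Fy => [|k] IHk IHi hy Fy.
      by rewrite (ideal_part0 hGfilt hy).
    have [v hv hyv] := hy.
    have hXv : ideal_part (F k.+1) i (X i *: pr v).
      rewrite -linearZ -[X i *: v](subKr y) linearB.
      apply: (RsubmodB (ideal_part_submod hX _ (hFk _))).
        exact: ideal_part_incl.
      exact: (ideal_part_map (graph_filt k.+1)).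
    have [v' hv' v'E] := ideal_part_lift (hG k) (graph_onto k)
      (reg _ _ _ ilt (graph_filt _ _ hv) hXv).
    have e : v - v' = 0.
      apply: IHk; last by rewrite linearB v'E subrr.
      apply: (RsubmodB (hG k.+1)) => //.
      by apply: (ideal_part_filtS hGfilt _ hv'); apply: ltnW.
    move/eqP: e; rewrite subr_eq0 => /eqP e.
    apply: IHi => //; first exact: ltnW.
    rewrite -[y](subrK (X i *: v)).
    apply: (RsubmodD (ideal_part_submod hX _ (hG _))) => //.
    by rewrite e; apply: (ideal_partX hX) => //; apply: ltnW.
  (* A vanishing first component leaves no room for a generator of top degree. *)
  have w0 : w = 0.
    apply: (s_inj k); have := ideal_part_map (graph_filt k) hw.
    rewrite linearB z0 sub0r (prE (st k w)) /=.
    move=> /(RsubmodN (ideal_part_submod hX _ (hFk _))).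
    by rewrite opprK.
  apply: IHk => //; apply: (strict n) => //.
    by move: hw; rewrite w0 st0 subr0.
  by rewrite z0; case: (hFk k).
have graph_leq k j z : (k <= j)%N -> graph k z -> graph j z.
  move=> kj hz; rewrite -(subnK kj); elim: (j - k)%N => // m IH.
  exact: (filtS hGfilt).
pose Graph z := exists k, graph k z.
have hGraph : Rsubmod Graph.
  split=> [|r u v [k hu] [j hv]]; first by exists 0%N.
  exists (k + j)%N; case: (hG (k + j)%N) => _; apply.
    by apply: graph_leq hu; rewrite leq_addr.
  by apply: graph_leq hv; rewrite leq_addl.
have GraphA a z : Graph z -> Graph (a *: z).
  apply: (Rsubmod_stable hX _ hGraph) => i u ilt [k hu].
  by exists k.+1; apply: (filtX hGfilt).
have Graph_inj z z' : Graph z -> Graph z' -> z.1 = z'.1 -> z = z'.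
  move=> hz hz' e; apply/eqP; rewrite -subr_eq0; apply/eqP.
  have [k hk] := RsubmodB hGraph hz hz'.
  by apply: (graph_inj k) => //; rewrite prE /= e subrr.
have Graph_lift z : Graph z -> g z.2 = f z.1.
  have hZ : Rsubmod (fun z : N * M => g z.2 = f z.1).
    split=> [|r u v /= hu hv]; first by rewrite !linear0.
    by rewrite !linearP hu hv.
  move=> [k]; elim: k z => [|k IH] z /=; first by move=> ->; rewrite !linear0.
  move=> [w hw].
  rewrite -[z](subrK (st k w)); apply: (RsubmodD hZ); last first.
    exact: st_lift.
  apply: (ideal_part_sub (iota := iota) (n := n) hZ _ IH _ hw) => // i u ilt hu.
  by rewrite !linearZ /= IH.
have /choice[h hE] u : exists m, Graph (u, m).
  have [k /graph_onto[[v m] hz]] := exF u.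
  by rewrite prE /= => <-; exists m, k.
have lh : linear h.
  move=> a u v.
  have e : (a *: u + v, h (a *: u + v)) = a *: (u, h u) + (v, h v).
    apply: Graph_inj => //; apply: (RsubmodD hGraph) => //; exact: GraphA.
  by case: e.
have [h' h'E] := linear_ex lh.
by exists h' => u; rewrite h'E (Graph_lift _ (hE u)).
Qed.

(** Projectivity over [R] serves twice on each piece: it splits the piece off as [s k], and it lifts
    [f \o s k] through [g] as an [R]-linear [t k]. [regular_lift] then extends these lifts to an
    [A]-linear map. *)
Lemma regular_projective (N : lmodType A) (F : nat -> N -> Prop) :
  filtration F -> (forall u, exists k, F k u) -> regular X F n ->
  (forall k, exists (W : lmodType R) (p : N -> W),
     subquotient (F k.+1) (ideal_part (F k) n) p /\ projective W) ->
  projective N.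
Proof.
move=> hF exF reg /choice[W /dependent_choice[p hWp]] M N' g f gs.
have hFk := filt_submod hF.
have hp k := (hWp k).1; have pW k := (hWp k).2.
have /dependent_choice[s hs] k := subquotient_section (hFk _) (hp k) (pW k).
have ht k : exists t : W k -> M,
    (forall r v w, t (r *: v + w) = iota r *: t v + t w) /\
    forall w, g (t w) = f (s k w).
  have [ls _ _] := hs k.
  have lg : linear (g : restr_scalars M iota -> restr_scalars N' iota).
    by move=> r u v; rewrite restr_scaleE linearP.
  have lf : linear (fun w => f (s k w) : restr_scalars N' iota).
    by move=> r u v; rewrite ls linearP.
  have [gR gRE] := linear_ex lg; have [fs fsE] := linear_ex lf.
  have gRs y : exists x, gR x = y by have [x <-] := gs y; exists x; rewrite gRE.
  have [t tE] := pW k _ _ gR fs gRs.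
  exists t; split=> [r v w|w]; first by rewrite linearP.
  by rewrite -fsE -tE gRE.
have /dependent_choice[t {}ht] := ht.
apply: (regular_lift (W := W) (s := s) (t := t) hF exF reg) => k.
- by have [] := hs k.
- exact: (ht k).1.
- by have [] := hs k.
- move=> u hu; have [_ Fs ps] := hs k.
  exists (p k u); apply/(sq_ker (hp k)); first exact: (RsubmodB (hFk _)).
  by rewrite (sqB (hp k)) // ps subrr.
- by move=> w hw; have [_ Fs ps] := hs k; rewrite -[w]ps; apply/(sq_ker (hp k)).
- exact: (ht k).2.
Qed.

End RegularFiltrations.

(** * Bounding the global dimension of a filtered ring *)

Section FiniteGlobalDimension.
Variables (R A : pzRingType) (iota : {rmorphism R -> A}).
Variables (n : nat) (X : nat -> A).
Hypothesis hX : normal_generators iota n X.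

Local Notation Rsubmod := (Rsubmod iota).
Local Notation filtration := (filtration iota n X).
Local Notation ideal_part := (ideal_part X).

Lemma subquotient_map (N N' : lmodType A) (f : {linear N -> N'})
    (P Q : N -> Prop) (P' Q' : N' -> Prop) (W W' : lmodType R)
    (p : N -> W) (p' : N' -> W') :
  Rsubmod P -> (forall u, P u -> P' (f u)) -> (forall u, Q u -> Q' (f u)) ->
  subquotient iota P Q p -> subquotient iota P' Q' p' ->
  exists g : {linear W -> W'}, forall u, P u -> g (p u) = p' (f u).
Proof.
move=> hP Pf Qf hp hp'.
have /choice[s sE] : forall w, exists u, P u /\ p u = w.
  by move=> w; have [u hu e] := sq_onto hp w; exists u.
have well u v : P u -> P v -> p u = p v -> p' (f u) = p' (f v).
  move=> hu hv e; apply/eqP; rewrite -subr_eq0.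
  have huv : P (u - v) by apply: (RsubmodB hP).
  have /(sq_ker hp huv)/Qf/(sq_ker hp' (Pf _ huv)) : p (u - v) = 0.
    by rewrite (sqB hp) // e subrr.
  by rewrite linearB (sqB hp') => [->||]; last exact: Pf; last exact: Pf.
have lg : linear (fun w => p' (f (s w))).
  move=> r v w; have [[hv ev] [hw ew]] := (sE v, sE w).
  rewrite -(sq_lin hp'); [|exact: Pf|exact: Pf].
  rewrite -linearP; apply: well; first exact: (sE _).1.
    by case: hP => _; apply.
  by rewrite (sE _).2 (sq_lin hp) // ev ew.
have [g gE] := linear_ex lg.
exists g => u hu; rewrite gE; apply: well => //; first exact: (sE _).1.
exact: (sE _).2.
Qed.

(** The hypotheses below describe an exhaustive filtration of [A] for which the variables are a
    regular sequence on the graded ring, with quotient [R] in degree 0. *)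
Variable FA : nat -> A -> Prop.
Hypothesis iota_inj : injective iota.
Hypothesis hFA : filtration (FA : nat -> A^o -> Prop).
Hypothesis FA_ex : forall a, exists k, FA k a.
Hypothesis FA_reg : regular X (FA : nat -> A^o -> Prop) n.
Hypothesis FA1 : forall a, FA 1%N a <-> exists r, iota r = a.
Hypothesis FA_top : forall k a, FA k.+2 a ->
  ideal_part (FA k.+1 : A^o -> Prop) n a.

Lemma filt_leq (N : lmodType A) (F : nat -> N -> Prop) j k u :
  filtration F -> (j <= k)%N -> F j u -> F k u.
Proof.
move=> hF jk hu; rewrite -(subnK jk); elim: (k - j)%N => // m IH.
exact: (filtS hF).
Qed.

(** Indices are strict degree bounds: degrees below [k] and below [b.+1] add up to a degree below
    [k + b]. *)
Lemma filt_action (N : lmodType A) (F : nat -> N -> Prop) k b a u :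
  filtration F -> FA k a -> F b.+1 u -> F (k + b)%N (a *: u).
Proof.
move=> hF; have hk := filt_submod hF.
elim: k a u => [|k IH] a u ha hu.
  by rewrite (filt0 hFA ha) scale0r; case: (hk (0 + b)%N).
case: k IH ha => [|k] IH ha.
  by move/FA1: ha => [r <-]; apply: (RsubmodZ _ (hk _)).
pose Z (a : A^o) := forall u, F b.+1 u -> F (k.+2 + b)%N ((a : A) *: u).
have hZ : Rsubmod Z.
  have [F0 FP] := hk (k.+2 + b)%N.
  split=> [v _|r v w hv hw y hy]; first by rewrite scale0r.
  by rewrite scalerDl -scalerA; apply: FP; [exact: hv | exact: hw].
apply: (ideal_part_sub (iota := iota) (n := n) hZ _ _ _ (FA_top ha)) => //.
  move=> i v ilt hv w hw; rewrite -[_ *: _]scalerA.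
  by apply: (filtX hF) => //; apply: IH.
by move=> v hv w hw; apply: (filtS hF); apply: IH.
Qed.

(** One free generator [(j, v)] is placed in degree [j] for all [j] and [v]. With truncated
    subtraction, [FA (k - j)] is 0 for [k <= j], so the generator first appears in step [j.+1]. *)
Lemma filtered_cover (N : lmodType A) (F : nat -> N -> Prop) :
  filtration F -> (forall u, exists k, F k u) ->
  exists (L : lmodType A) (FL : nat -> L -> Prop) (q : {linear L -> N}),
   [/\ filtration FL, forall u, exists k, FL k u, regular X FL n &
    [/\ forall k, exists (W : lmodType R) (p : L -> W),
         subquotient iota (FL k.+1) (ideal_part (FL k) n) p /\ projective W,
       forall k u, FL k u -> F k (q u) &
       forall k v, F k v -> exists2 u, FL k u & q u = v]].
Proof.
move=> hF exF; have hk := filt_submod hF; have hAk := filt_submod hFA.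
have A0 k : FA k 0 by case: (hAk k).
pose G : choiceType := (nat * N)%type.
have [L [coord cL]] := free_module_ex A G.
pose FL k u := forall g : G, FA (k - g.1) (coord u g).
have hFL : filtration FL.
  split=> [u hu|k|k u hu g|k i u ilt hu g].
  - apply: (coord_inj cL) => g; rewrite (coord0 cL).
    by apply: (filt0 hFA); apply: hu.
  - split=> [g|r u v hu hv g]; first by rewrite (coord0 cL).
    by rewrite (coordP cL); case: (hAk (k - g.1)%N) => _; apply.
  - by apply: (filt_leq hFA) (hu g); rewrite leq_sub2r.
  - rewrite (coordZ cL); have [gk|gk] := leqP g.1 k.
      by rewrite subSn //; apply: (filtX hFA).
    have := hu g; rewrite (eqP (ltnW gk)) => /(filt0 hFA) ->.
    by rewrite mulr0.
have IL i k u : ideal_part (FL k) i u <->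
    forall g, ideal_part (FA (k - g.1) : A^o -> Prop) i (coord u g).
  elim: i u => [|i IH] u //; split.
    move=> [w hw /IH h] g; exists (coord w g); first exact: hw.
    by have := h g; rewrite (coordB cL) (coordZ cL).
  move=> h; have [s _ hs] := coord_fin cL u.
  (* The last clause forces the coordinatewise choices to have finite support, so that they assemble
     into an element of [L]. *)
  have /choice[f hf] g : exists w, [/\ FA (k - g.1) w,
      ideal_part (FA (k - g.1) : A^o -> Prop) i (coord u g - X i * w) &
      g \notin s -> w = 0].
    have [gs|gs] := boolP (g \in s).
      by have [w hw hw'] := h g; exists w.
    exists 0; rewrite mulr0 subr0 hs //; split=> //.
    by case: (ideal_part_submod hX i (hAk (k - g.1)%N)).
  have [w wE] : exists w, coord w =1 f.
    by apply: (coord_onto cL (s := s)) => g gs; have [_ _ ->] := hf g.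
  exists w => [g|]; first by rewrite wE; have [] := hf g.
  by apply/IH => g; rewrite (coordB cL) (coordZ cL) wE; have [] := hf g.
(* Generators whose degree does not fit their value are sent to 0, which keeps [q] filtered. *)
pose phi (g : G) := if `[< F g.1.+1 g.2 >] then g.2 else 0.
have Fphi g : F g.1.+1 (phi g).
  by rewrite /phi; case: asboolP => // _; case: (hk g.1.+1).
have [q qE] := coord_lift cL phi.
exists L, FL, q; split=> //.
- move=> u; have [s us hs] := coord_fin cL u.
  have /choice[kk kkE] g := FA_ex (coord u g).
  exists (\sum_(g <- s) (kk g + g.1))%N => g.
  have [gs|gs] := boolP (g \in s); last by rewrite hs.
  apply: (filt_leq hFA) (kkE g).
  by rewrite (big_rem g) //= addnAC addnK leq_addr.
- move=> i k u ilt hu /IL hXu; apply/IL => g.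
  have [gk|gk] := leqP g.1 k.
    have e : (k.+1 - g.1)%N = (k - g.1).+1 by apply: subSn.
    apply: FA_reg => //; rewrite -e; first exact: hu.
    by have := hXu g; rewrite (coordZ cL).
  have -> : coord u g = 0.
    by apply: (filt0 hFA); have := hu g; rewrite (eqP gk).
  by case: (ideal_part_submod hX i (hAk (k - g.1)%N)).
split.
- move=> k.
  (* Modulo the variables only generators of degree exactly [k] survive, with coefficients in
     [FA 1], the image of [R]. *)
  have [W [cW cWP]] := free_module_ex R (N : choiceType).
  have /choice[p pE] u : exists w, FL k.+1 u ->
      forall y, iota (cW w y) = coord u (k, y).
    have [hu|hu] := pselect (FL k.+1 u); last by exists 0.
    have /choice[f fE] y : exists r, iota r = coord u (k, y).
      by apply/FA1; have := hu (k, y); rewrite /= subSnn.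
    have [s _ hs] := coord_fin cL u.
    have [w wE] : exists w, cW w =1 f.
      apply: (coord_onto cWP (s := map snd s)) => y ys.
      apply: iota_inj; rewrite fE rmorph0; apply: hs.
      by apply: contra ys => ys; apply/mapP; exists (k, y).
    by exists w => _ y; rewrite wE fE.
  exists W, p; split; last exact: free_projective cWP.
  split.
  + move=> r u v hu hv; apply: (coord_inj cWP) => y; apply: iota_inj.
    have huv : FL k.+1 (iota r *: u + v).
      by case: (filt_submod hFL k.+1) => _; apply.
    by rewrite (coordP cWP) rmorphD rmorphM !pE // (coordP cL).
  + move=> u hu; split=> [pu0|/IL h]; last first.
      apply: (coord_inj cWP) => y; apply: iota_inj.
      rewrite pE // (coord0 cWP) rmorph0.
      have := h (k, y); rewrite /= subnn; exact: (ideal_part0 hFA).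
    apply/IL => -[j y] /=; have hI l := ideal_part_submod hX n (hAk l).
    have [jk|jk|->] := ltngtP j k.
    * have := hu (j, y); rewrite /= subSn ?(ltnW jk) //.
      by move: jk; rewrite -subn_gt0; case: (k - j)%N => // m _; apply: FA_top.
    * have := hu (j, y); rewrite /= (eqP jk) => /(filt0 hFA) ->.
      by case: (hI (k - j)%N).
    * by rewrite -pE // pu0 (coord0 cWP) rmorph0; case: (hI (k - k)%N).
  + move=> w; have [s us hs] := coord_fin cWP w.
    pose f (g : G) := if g.1 == k then iota (cW w g.2) else 0.
    have [u uE] : exists u, coord u =1 f.
      apply: (coord_onto cL (s := map (pair k) s)) => -[j y] /=; rewrite /f /=.
      case: eqP => // -> ys; rewrite hs ?rmorph0 //.
      by apply: contra ys => ys; apply/mapP; exists y.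
    have hu : FL k.+1 u.
      move=> [j y]; rewrite uE /f /=; case: eqP => // ->.
      by rewrite subSnn; apply/FA1; exists (cW w y).
    exists u => //; apply: (coord_inj cWP) => y; apply: iota_inj.
    by rewrite pE // uE /f /= eqxx.
- move=> k u hu; have [s us hs] := coord_fin cL u.
  rewrite (qE u s us hs); apply: (Rsubmod_sum (iota := iota)) => // g.
  have [gk|gk] := leqP g.1 k.
    by rewrite -[k](subnK gk); apply: filt_action; rewrite // subnK.
  have := hu g; rewrite (eqP (ltnW gk)) => /(filt0 hFA) ->.
  by rewrite scale0r; case: (hk k).
- case=> [|k] v hv.
    exists 0; last by rewrite linear0 (filt0 hF hv).
    by move=> g; rewrite (coord0 cL).
  have [e eE] := basis_ex cL.
  exists (e (k, v)) => [[j y]|].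
    rewrite eE; case: eqP => [[-> _]|_] //=.
    by rewrite subSnn; apply/FA1; exists 1; rewrite rmorph1.
  rewrite (qE _ [:: (k, v)]) // => [|g].
    by rewrite big_seq1 eE eqxx scale1r /phi /=; case: asboolP.
  by rewrite inE eE eq_sym => /negPf ->.
Qed.

(** Reducing modulo the variables is exact here: injectivity on the left is [ideal_part_kernel] for
    all [n] variables. *)
Lemma kernel_subquotients (U L N : lmodType A) (i : {linear U -> L})
    (q : {linear L -> N}) (FL : nat -> L -> Prop) (FN : nat -> N -> Prop) k
    (WU WL WN : lmodType R) (pU : U -> WU) (pL : L -> WL) (pN : N -> WN) :
  let FU k u := FL k (i u) in
  short_exact i q -> filtration FL -> filtration FN ->
  (forall k u, FL k u -> FN k (q u)) ->
  (forall k v, FN k v -> exists2 u, FL k u & q u = v) -> regular X FN n ->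
  subquotient iota (FU k.+1) (ideal_part (FU k) n) pU ->
  subquotient iota (FL k.+1) (ideal_part (FL k) n) pL ->
  subquotient iota (FN k.+1) (ideal_part (FN k) n) pN ->
  exists (f : {linear WU -> WL}) (g : {linear WL -> WN}), short_exact f g.
Proof.
move=> FU hs hL hN q_filt q_onto rN hU' hL' hN'.
have hU : filtration FU by apply: kernel_filtration hs hL.
have hUk := filt_submod hU; have hLk := filt_submod hL.
have [f fE] : exists f : {linear WU -> WL},
    forall u, FU k.+1 u -> f (pU u) = pL (i u).
  by apply: (subquotient_map _ _ _ hU' hL') => // u; apply: ideal_part_map.
have [g gE] : exists g : {linear WL -> WN},
    forall u, FL k.+1 u -> g (pL u) = pN (q u).
  apply: (subquotient_map _ _ _ hL' hN') => // [u|u]; first exact: q_filt.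
  exact: (ideal_part_map (q_filt k)).
have [ii qs ex] := hs.
exists f, g; split.
- have f0 w : f w = 0 -> w = 0.
    have [u hu <-] := sq_onto hU' w; rewrite fE // => /(sq_ker hL' hu) h.
    apply/(sq_ker hU' hu).
    exact: (ideal_part_kernel hX hs hL hN q_filt q_onto rN _ (leqnn n) h).
  move=> v w e; apply/eqP; rewrite -subr_eq0; apply/eqP/f0.
  by rewrite linearB e subrr.
- move=> w; have [v hv <-] := sq_onto hN' w.
  by have [u hu <-] := q_onto _ _ hv; exists (pL u); rewrite gE.
- move=> w; split=> [|[v <-]]; last first.
    have [u hu <-] := sq_onto hU' v; rewrite fE // gE //.
    have -> : q (i u) = 0 by apply/ex; exists u.
    apply/(sq_ker hN'); first by case: (filt_submod hN k.+1).
    by case: (ideal_part_submod hX n (filt_submod hN k)).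
  have [u hu <-] := sq_onto hL' w; rewrite gE // => h.
  have /(ideal_part_lift (hLk k) (q_onto k))[u' hu' qu'] :
      ideal_part (FN k) n (q u) by apply/(sq_ker hN' (q_filt _ _ hu)).
  have Fu' : FL k.+1 u' by apply: (ideal_part_filtS hL (leqnn n) hu').
  have /ex[t tE] : q (u - u') = 0 by rewrite linearB qu' subrr.
  exists (pU t); rewrite fE; last by rewrite /FU tE; apply: (RsubmodB (hLk _)).
  rewrite tE (sqB hL') // (_ : pL u' = 0) ?subr0 //.
  by apply/(sq_ker hL' Fu').
Qed.

(** The kernel of a filtered cover is again regular, and its reduced pieces are kernels of
    projective covers of the reduced pieces of [N]; Schanuel's lemma lowers their dimension by
    one. *)
Lemma regular_projdim m (N : lmodType A) (F : nat -> N -> Prop) :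
  filtration F -> (forall u, exists k, F k u) -> regular X F n ->
  (forall k (W : lmodType R) (p : N -> W),
     subquotient iota (F k.+1) (ideal_part (F k) n) p -> projdim_le m W) ->
  projdim_le m N.
Proof.
elim: m N F => [|m IH] N F hF exF reg hW.
  apply: (regular_projective hX hF exF reg) => k.
  have [W [p hp]] := subquotient_ex (filt_submod hF k.+1)
    (ideal_part_submod hX n (filt_submod hF k)).
  by exists W, p; split=> //; apply: hW hp.
have [L [FL [q [hL exL rL [wL q_filt q_onto]]]]] := filtered_cover hF exF.
have [U [i [ii ex]]] := kernel_ex q.
have hs : short_exact i q.
  split=> // v; have [k hv] := exF v.
  by have [u _ <-] := q_onto k v hv; exists u.
have hU := kernel_filtration hs hL.
exists U, L, i, q; split=> //.
  exact: (regular_projective hX hL exL rL wL).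
apply: IH hU _ _ _ => [u||k WU pU hpU]; first exact: exL.
  apply: (kernel_regular hX hs hL hF q_filt q_onto (leqnn n) (leqnn n)) => //.
have [WL [pL [hpL pWL]]] := wL k.
have [WN [pN hpN]] := subquotient_ex (filt_submod hF k.+1)
    (ideal_part_submod hX n (filt_submod hF k)).
have [f [g fg]] := kernel_subquotients hs hL hF q_filt q_onto reg hpU hpL hpN.
exact: (projdim_le_kernel fg pWL (hW _ _ _ hpN)).
Qed.

(** Here [i] counts the variables not yet known to be regular; passing to a kernel costs one unit of
    dimension and removes one of them. *)
Lemma filtered_projdim m i (N : lmodType A) (F : nat -> N -> Prop) :
  (forall W : lmodType R, projdim_le m W) -> (i <= n)%N ->
  filtration F -> (forall u, exists k, F k u) -> regular X F (n - i) ->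
  projdim_le (i + m) N.
Proof.
move=> hm; elim: i N F => [|i IH] N F ilt hF exF reg.
  by apply: (regular_projdim hF exF) => //; rewrite -[n]subn0.
have [L [FL [q [hL exL rL [wL q_filt q_onto]]]]] := filtered_cover hF exF.
have [U [j [jj ex]]] := kernel_ex q.
have hs : short_exact j q.
  split=> // v; have [k hv] := exF v.
  by have [u _ <-] := q_onto k v hv; exists u.
exists U, L, j, q; split=> //.
  exact: (regular_projective hX hL exL rL wL).
apply: (IH U (fun k u => FL k (j u))) => //; first exact: ltnW.
- exact: kernel_filtration hs hL.
- apply: (kernel_regular hX hs hL hF q_filt q_onto _ _ _ rL reg).
  + exact: leq_subr.
  + exact: leq_subr.
  + by rewrite subnS prednK // subn_gt0.
Qed.

Lemma global_dimension_le m : lgld_le R m -> lgld_le A (n + m).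
Proof.
move=> hR N; apply/projdim_leP.
pose F k (u : N) := if k is 0%N then u = 0 else True.
apply: (filtered_projdim (F := F)) => //.
- by move=> W; apply/projdim_leP/hR.
- split=> [//|[|k]|[]|[|k] i u] //=.
  + by split=> // r u v -> ->; rewrite scaler0 addr0.
- by move=> u; exists 1%N.
- by rewrite subnn => i k u; rewrite ltn0.
Qed.

End FiniteGlobalDimension.

(** * The degree filtration of a skew PBW extension *)

Section Coordinates.
Variables (K : fieldType) (R A : algType K) (n : nat).
Variables (iota : {lrmorphism R -> A}) (x : 'I_n -> A).
Hypothesis hA : skew_PBW iota x.

Local Notation monomial := {ffun 'I_n -> nat}.
Local Notation AR :=
  (restr_scalars (A^o : lmodType A) (iota : {rmorphism R -> A})).

Lemma pbw_coordinates : exists coord : AR -> monomial -> R,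
  coordinates coord /\
  forall al be, coord (std_monomial x al) be = (al == be)%:R.
Proof.
have [L [c cP]] := free_module_ex R monomial.
have [f fE] := coord_lift cP (fun al => std_monomial x al : AR).
have [e eE] := basis_ex cP.
have fe al : f (e al) = std_monomial x al.
  rewrite (fE _ [:: al]) // => [|be]; first by rewrite big_seq1 eE eqxx scale1r.
  by rewrite inE eE eq_sym => /negPf ->.
have f_surj a : exists u, f u = a.
  have [s [r ->]] := pbw_span hA a.
  exists (\sum_(al <- s) r al *: e al); rewrite linear_sum.
  by apply: eq_bigr => al _; rewrite linearZ /= fe.
have f_inj u v : f u = f v -> u = v.
  move=> e0; apply/eqP; rewrite -subr_eq0; apply/eqP.
  have [s us hs] := coord_fin cP (u - v).
  have f0 : std_combination iota x s (c (u - v)) = 0.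
    by rewrite -[LHS](fE _ s us hs) linearB e0 subrr.
  apply: (coord_inj cP) => al; rewrite (coord0 cP).
  have [als|/hs //] := boolP (al \in s).
  exact: (pbw_free hA us f0).
have /choice[g gK] := f_surj.
have lg : linear g by move=> r u v; apply: f_inj; rewrite linearP !gK.
exists (fun a => c (g a)); split; last first.
  by move=> al be; rewrite -fe (f_inj _ _ (gK _)) eE.
split=> [r u v be|u v h|u|h s hs].
- by rewrite lg (coordP cP).
- by rewrite -[u]gK -[v]gK; congr (f _); apply: (coord_inj cP).
- exact: (coord_fin cP).
- have [u uE] := coord_onto cP hs.
  by exists (f u); rewrite (f_inj _ _ (gK _)).
Qed.

End Coordinates.

Section PBWFiltration.
Variables (K : fieldType) (R A : algType K) (n : nat).
Variables (iota : {lrmorphism R -> A}) (x : 'I_n -> A).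
Variables (sigma delta : 'I_n -> R -> R).
Variables (c : 'I_n -> 'I_n -> R) (a : 'I_n -> 'I_n -> 'I_n -> R).
Variable (d : 'I_n -> 'I_n -> R).
Hypotheses (hA : skew_PBW iota x) (hsd : pbw_twists iota x sigma delta).
Hypotheses (hcad : pbw_constants iota x c a d).
Hypothesis hsigma : forall i, bijective (sigma i).

Local Notation monomial := {ffun 'I_n -> nat}.
Local Notation AR :=
  (restr_scalars (A^o : lmodType A) (iota : {rmorphism R -> A})).
Local Notation std := (std_monomial x).

(* [var i] is the junk value [0] for [i >= n]. *)
Definition var (i : nat) : A := oapp x 0 (insub i).

Lemma varE (i : 'I_n) : var i = x i.
Proof. by rewrite /var valK. Qed.

Lemma var_out i : (n <= i)%N -> var i = 0.
Proof. by move=> h; rewrite /var insubN // -leqNgt. Qed.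

Lemma pbw_normal_generators :
  normal_generators (iota : {rmorphism R -> A}) n var.
Proof.
split=> [i r|i j ilt jlt|D D1 DD DR DX b].
- have [ilt|/var_out ->] := ltnP i n; last first.
    by exists 0, 0; rewrite mul0r mulr0 rmorph0 addr0.
  have [s _ sK] := hsigma (Ordinal ilt).
  (* This is the twist relation applied to the preimage [s r] of [r] under [sigma]. *)
  exists (s r), (- delta (Ordinal ilt) (s r)).
  by rewrite (varE (Ordinal ilt)) hsd sK rmorphN addrK.
- exists (c (Ordinal ilt) (Ordinal jlt)).
  exists (fun k => oapp (a (Ordinal ilt) (Ordinal jlt)) 0 (insub k)).
  exists (d (Ordinal ilt) (Ordinal jlt)).
  rewrite (varE (Ordinal ilt)) (varE (Ordinal jlt)) hcad.
  by congr (_ + _ + _); apply: eq_bigr => k _; rewrite varE valK.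
have D0 : D 0 by rewrite -(mul0r 1) -(rmorph0 iota); apply: DR.
have Dstd al : D (std al).
  apply: big_rec => // i u _ hu.
  elim: (al i) => [|m IH]; first by rewrite mul1r.
  by rewrite exprS -mulrA -[x i]varE; apply: DX (ltn_ord i) _; rewrite varE.
have [s [r ->]] := pbw_span hA b.
apply: (big_ind (fun b => D b)) => // al _; exact: DR.
Qed.

Section Degree.
Variable coord : AR -> monomial -> R.
Hypothesis hcoord : coordinates coord.
Hypothesis coord_std : forall al be, coord (std al) be = (al == be)%:R.

Definition mdegree (al : monomial) : nat := \sum_i al i.

Definition raise (i : 'I_n) (al : monomial) : monomial :=
  [ffun j => (al j + (i == j))%N].

Definition lower (i : 'I_n) (al : monomial) : monomial :=
  [ffun j => (al j - (i == j))%N].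

Lemma mdegree_raise i al : mdegree (raise i al) = (mdegree al).+1.
Proof.
rewrite /mdegree (eq_bigr (fun j => (al j + (i == j))%N)) => [|j _]; last first.
  by rewrite ffunE.
rewrite big_split /= -addn1; congr (_ + _)%N.
by rewrite (bigD1 i) //= eqxx big1 // => j /negPf; rewrite eq_sym => ->.
Qed.

Lemma lowerK i (al : monomial) : (0 < al i)%N -> raise i (lower i al) = al.
Proof.
move=> h; apply/ffunP => j; rewrite !ffunE.
by case: eqP => [<-|_]; rewrite ?subn0 ?addn0 // subnK.
Qed.

Lemma raise_inj i : injective (raise i).
Proof.
move=> al be /ffunP h; apply/ffunP => j.
by have := h j; rewrite !ffunE => /addIn.
Qed.

Lemma raiseC i j (al : monomial) : raise i (raise j al) = raise j (raise i al).
Proof. by apply/ffunP => k; rewrite !ffunE addnAC. Qed.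

(** Without variables before [x i], multiplication by [x i] just merges into its power. The proof
    relies on the product being taken over a sorted enumeration. *)
Lemma std_raise (i : 'I_n) (al : monomial) :
  (forall l : 'I_n, (l < i)%N -> al l = 0%N) -> x i * std al = std (raise i al).
Proof.
move=> h; rewrite /std_monomial.
have : sorted ltn (map val (index_enum 'I_n)).
  by rewrite [index_enum _]unlock -enumT val_enum_ord; apply: iota_ltn_sorted.
have : i \in index_enum 'I_n by exact: mem_index_enum.
elim: (index_enum _) => // j s IH; rewrite inE !big_cons ffunE.
have [<- _|ij /= js sj] := eqVneq i j.
  rewrite /= => /(order_path_min ltn_trans)/allP sj.
  rewrite mulrA -exprS addn1; congr (_ * _).
  apply: eq_big_seq => k ks; rewrite ffunE.
  case: eqP => [e|_]; rewrite ?addn0 //.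
  by have /sj := map_f val ks; rewrite /= -e ltnn.
have /(order_path_min ltn_trans)/allP := sj.
move=> /(_ _ (map_f val js)) /= ji.
by rewrite h // addn0 !expr0 !mul1r IH //; apply: path_sorted sj.
Qed.

Lemma std0 : std [ffun=> 0%N] = 1.
Proof. by apply: big1 => i _; rewrite ffunE expr0. Qed.

Definition supported (P : monomial -> Prop) (u : A) : Prop :=
  forall al, coord u al != 0 -> P al.

Lemma supported_submod P :
  Rsubmod (iota : {rmorphism R -> A}) (supported P : A^o -> Prop).
Proof.
split=> [al|r u v hu hv al]; first by rewrite (coord0 hcoord) eqxx.
rewrite -[iota r *: u + v]/((r *: (u : AR) + v) : AR) (coordP hcoord) => h.
have [u0|] := eqVneq (coord u al) 0; last exact: hu.
by apply: hv; move: h; rewrite u0 mulr0 add0r.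
Qed.

Lemma coord_mull r u al : coord (iota r * u) al = r * coord u al.
Proof. exact: (coordZ hcoord). Qed.

Lemma supported_std P r al : P al -> supported P (iota r * std al).
Proof.
move=> hP be; rewrite -[iota r * _]/((r *: (std al : AR)) : AR) (coordZ hcoord).
by rewrite coord_std; have [<- //|_] := eqVneq al be; rewrite mulr0 eqxx.
Qed.

Lemma supported_ind P (Z : A -> Prop) u :
  Rsubmod (iota : {rmorphism R -> A}) (Z : A^o -> Prop) ->
  (forall r al, P al -> Z (iota r * std al)) -> supported P u -> Z u.
Proof.
move=> hZ Zstd hu; have [s us hs] := coord_fin hcoord u.
rewrite (coord_expand hcoord coord_std us hs).
apply: (Rsubmod_sum _ hZ) => al.
have [->|/hu hP] := eqVneq (coord u al) 0; first by rewrite scale0r; case: hZ.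
exact: Zstd.
Qed.

Lemma supportedD P u v : supported P u -> supported P v -> supported P (u + v).
Proof. exact: (RsubmodD (supported_submod P)). Qed.

Lemma supportedZ P r u : supported P u -> supported P (iota r * u).
Proof. exact: (RsubmodZ r (supported_submod P)). Qed.

Lemma supported_leq (P Q : monomial -> Prop) u :
  (forall al, P al -> Q al) -> supported P u -> supported Q u.
Proof. by move=> PQ hu al /hu/PQ. Qed.

Definition pbw_filt (k : nat) : A -> Prop :=
  supported (fun al => mdegree al < k)%N.

Lemma pbw_filt_leq j k u : (j <= k)%N -> pbw_filt j u -> pbw_filt k u.
Proof. by move=> jk; apply: supported_leq => al h; apply: leq_trans jk. Qed.

Lemma pbw_filt_std al k : (mdegree al < k)%N -> pbw_filt k (std al).
Proof.
by move=> h; rewrite -[std al]mul1r -(rmorph1 iota); apply: supported_std.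
Qed.

(** The coefficient of the leading monomial is left unspecified: bounding degrees needs only the
    monomial, and [std_raise] supplies the coefficient where it matters. *)
Definition straight (al : monomial) : Prop := forall i, exists r b,
  x i * std al = iota r * std (raise i al) + b /\ pbw_filt (mdegree al).+1 b.

Lemma supported_mulx P Q i u : (forall al, P al -> straight al) ->
  (forall al be, P al ->
     (mdegree be <= mdegree al)%N \/ be = raise i al -> Q be) ->
  supported P u -> supported Q (x i * u).
Proof.
move=> hS PQ hu.
(* The summand [delta i r] leaves a multiple of the unmultiplied monomial, so its support has to be
   carried through the induction. *)
suff [] : supported Q (x i * u) /\ supported Q u by [].
have PQ' al : P al -> Q al by move=> h; apply: (PQ al) => //; left.
apply: (supported_ind (Z := fun u => supported Q (x i * u) /\ supported Q u)) hu.
  have [Q0 QP] := supported_submod Q.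
  split=> [|r v w [hv hv'] [hw hw']]; first by rewrite mulr0.
  split; last exact: QP.
  rewrite mulrDr -[_ *: v]/(iota r * v) mulrA hsd mulrDl -!mulrA.
  by apply: supportedD => //; apply: supportedD; apply: supportedZ.
move=> r al hP; split; last by apply: supported_std; apply: PQ'.
have [r' [b [e hb]]] := hS al hP i.
rewrite mulrA hsd mulrDl -mulrA e mulrDr mulrA -rmorphM.
apply: supportedD; first apply: supportedD.
- by apply: supported_std; apply: (PQ al) => //; right.
- apply: supportedZ; apply: supported_leq hb => be; rewrite ltnS => h.
  by apply: (PQ al) => //; left.
- by apply: supported_std; apply: PQ'.
Qed.

Lemma raise_first i (al : monomial) :
  (exists2 l : 'I_n, (l < i)%N & (0 < al l)%N) ->
  exists p : 'I_n, [/\ (p < i)%N, al = raise p (lower p al) &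
    forall l : 'I_n, (l < p)%N -> al l = 0%N].
Proof.
case=> l li hl.
case: (arg_minnP (P := fun l => (0 < al l)%N) val hl) => p hp pmin.
exists p; split; first exact: leq_ltn_trans (pmin _ hl) li.
  by rewrite lowerK.
move=> k kp; apply/eqP; rewrite -leqn0 leqNgt; apply/negP => /pmin /=.
by rewrite leqNgt kp.
Qed.

(** If some variable precedes [x i], let [x p] be the first one in the monomial and [ga] the rest.
    Exchanging [x i] with [x p], applying induction to [x i * std ga] and moving [x p] past the
    resulting coefficient puts [x p] back in front of a monomial where it comes first. *)
Lemma straightP al : straight al.
Proof.
have [m] := ubnP (mdegree al); elim: m al => // m IH al alm i.
have [h|h] := pselect (exists2 l : 'I_n, (l < i)%N & (0 < al l)%N); last first.
  exists 1, 0; split; last first.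
    by case: (supported_submod (fun be => mdegree be < (mdegree al).+1)%N).
  rewrite addr0 rmorph1 mul1r std_raise // => l li.
  by apply/eqP; rewrite -leqn0 leqNgt; apply/negP => hl; apply: h; exists l.
have [p [pi alE pmin]] := raise_first h.
move: (lower p al) alE => ga alE.
have dal : mdegree al = (mdegree ga).+1 by rewrite alE mdegree_raise.
have gamin (l : 'I_n) : (l < p)%N -> ga l = 0%N.
  move=> lp; have := pmin l lp; rewrite alE ffunE => /eqP.
  by rewrite addn_eq0 => /andP[/eqP].
have gam : (mdegree ga < m)%N by rewrite -ltnS -dal.
have stdE : std al = x p * std ga by rewrite std_raise // -alE.
have [r [b [e hb]]] := IH ga gam i.
have hx k v : pbw_filt (mdegree al) v -> pbw_filt (mdegree al).+1 (x k * v).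
  apply: supported_mulx => [be hbe|be ga' hbe [h1|->]].
  - by apply: IH; apply: leq_trans hbe _; rewrite -ltnS.
  - by apply: leq_ltn_trans h1 _; apply: ltnW.
  - by rewrite mdegree_raise.
exists (c p i * sigma p r).
exists (iota (c p i) * (iota (delta p r) * std (raise i ga)) +
  iota (c p i) * (x p * b) +
  \sum_k iota (a p i k) * (x k * std ga) + iota (d p i) * std ga); split.
  have -> : std (raise i al) = x p * std (raise i ga).
    rewrite std_raise ?alE 1?raiseC // => l lp; rewrite ffunE gamin //.
    by case: eqP => // il; move: lp; rewrite -il ltnNge ltnW.
  rewrite stdE mulrA hcad !mulrDl -!mulrA e mulrDr mulrA hsd.
  rewrite !mulrDr !mulrDl !mulrDr mulr_suml rmorphM -!mulrA !addrA.
  by under [in LHS]eq_bigr => k _ do rewrite -mulrA.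
have hga : pbw_filt (mdegree al) (std ga).
  by apply: pbw_filt_std; rewrite dal.
apply: supportedD; first apply: supportedD; first apply: supportedD.
- do 2!apply: supportedZ; apply: pbw_filt_std.
  by rewrite mdegree_raise dal.
- by apply: supportedZ; apply: hx; rewrite dal.
- apply: (Rsubmod_sum _ (supported_submod _)) => k; apply: supportedZ.
  exact: hx.
- by apply: supportedZ; apply: pbw_filt_leq hga.
Qed.

Local Notation FA := (pbw_filt : nat -> A^o -> Prop).
Local Notation IA := (ideal_part (N := A^o) var).

Lemma pbw_filtration : filtration (iota : {rmorphism R -> A}) n var FA.
Proof.
split=> [u hu|k|k u|k i u ilt].
- apply: (coord_inj hcoord) => al; rewrite (coord0 hcoord); apply/eqP.
  by apply/negPn/negP => /hu.
- exact: supported_submod.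
- exact: pbw_filt_leq.
- rewrite -[_ *: u]/(var i * u) (varE (Ordinal ilt)).
  apply: supported_mulx => [al _|al be hal [h|->]]; first exact: straightP.
    by apply: leq_ltn_trans h _; apply: ltnW.
  by rewrite mdegree_raise.
Qed.

Lemma pbw_filt_ex u : exists k, pbw_filt k u.
Proof.
have [s us hs] := coord_fin hcoord u.
exists (\sum_(al <- s) mdegree al).+1 => al hal.
have als : al \in s by apply: contraNT hal => /hs ->.
by rewrite ltnS (big_rem al) //= leq_addr.
Qed.

Lemma mdegree0 (al : monomial) : mdegree al = 0%N -> al = [ffun=> 0%N].
Proof.
move=> /eqP; rewrite /mdegree sum_nat_eq0 => /forallP h.
by apply/ffunP => i; rewrite ffunE; apply/eqP/h.
Qed.

Lemma pbw_filt1 u : pbw_filt 1 u <-> exists r, iota r = u.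
Proof.
split=> [|[r <-]]; last first.
  rewrite -[iota r]mulr1 -std0; apply: supported_std.
  by rewrite /mdegree big1 // => i _; rewrite ffunE.
apply: (supported_ind (Z := fun u => exists r, iota r = u)).
  split=> [|r v w [v' <-] [w' <-]]; first by exists 0; rewrite rmorph0.
  by exists (r * v' + w'); rewrite rmorphD rmorphM.
move=> r al; rewrite ltnS leqn0 => /eqP/mdegree0 ->.
by exists r; rewrite std0 mulr1.
Qed.

Definition ideal_monomial (i k : nat) (al : monomial) : Prop :=
  (mdegree al < k)%N \/
  mdegree al = k /\ exists2 l : 'I_n, (l < i)%N & (0 < al l)%N.

(** Ideal parts become conditions on monomials: either the degree is below [k], or it is [k] and one
    of the first [i] variables occurs. In the second case the first variable that occurs can be
    split off on the left. *)
Lemma ideal_part_supported i k u : (i <= n)%N ->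
  IA (pbw_filt k) i u <-> supported (ideal_monomial i k) u.
Proof.
have hFk := filt_submod pbw_filtration k; have hX := pbw_normal_generators.
move=> i_n; split.
  elim: i i_n u => [|i IH] ilt u.
    by apply: supported_leq => al h; left.
  move=> [w hw /(IH (ltnW ilt))].
  rewrite -[_ *: w]/(var i * w) (varE (Ordinal ilt)) => huw.
  rewrite -[u](subrK (x (Ordinal ilt) * w)); apply: supportedD.
    apply: supported_leq huw => al [h|[h [l li hl]]]; first by left.
    by right; split=> //; exists l => //; apply: ltnW.
  apply: supported_mulx hw => [al _|al be hal [h|->]]; first exact: straightP.
    by left; apply: leq_ltn_trans h hal.
  rewrite /ideal_monomial mdegree_raise; move: hal; rewrite leq_eqVlt.
  case/orP=> [/eqP <-|]; last by left.
  by right; split=> //; exists (Ordinal ilt) => //; rewrite ffunE eqxx addn1.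
have hI := ideal_part_submod hX i hFk.
apply: (supported_ind hI) => r al [h|[h]].
  by apply: (ideal_part_incl var i hFk); apply: supported_std.
move=> hl; have [p [pi alE pmin]] := raise_first hl.
move: (lower p al) alE => ga alE.
have gak : pbw_filt k (std ga).
  by apply: pbw_filt_std; rewrite -h alE mdegree_raise.
have -> : std al = x p * std ga.
  rewrite std_raise -?alE // => l lp; have := pmin l lp.
  by rewrite alE ffunE => /eqP; rewrite addn_eq0 => /andP[/eqP].
have [r1 [r2 rE]] := ng_right hX p r.
rewrite mulrA -varE rE mulrDl -mulrA.
apply: (RsubmodD hI); last first.
  by apply: (ideal_part_incl var i hFk); apply: supportedZ.
apply: (ideal_part_leq hFk pi); apply: (ideal_part_top hX _ hFk).
exact: supportedZ.
Qed.

(** [sigma] is a bare family of functions, so its value at 0 is read off from the coefficient of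
    [x i] in [x i * 0 = 0]. *)
Lemma sigma0 i : sigma i 0 = 0.
Proof.
pose z : monomial := [ffun=> 0%N].
have xE : x i = std (raise i z).
  by rewrite -std_raise ?std0 ?mulr1 // => l _; rewrite ffunE.
have neq : z == raise i z = false.
  by apply/eqP => /(congr1 mdegree); rewrite mdegree_raise => /n_Sn.
have := hsd i 0; rewrite rmorph0 mulr0 xE -[iota (delta i 0)]mulr1 -std0.
move=> /(congr1 (fun u => coord u (raise i z))).
rewrite (coordD hcoord) !coord_mull !coord_std eqxx neq mulr1 mulr0 addr0.
by rewrite (coord0 hcoord).
Qed.

(** A monomial [al] of top degree in [u] free of the first [i] variables would yield [raise i al] in
    the product with [x i], and that monomial is not allowed there. *)
Lemma pbw_regular : regular var FA n.
Proof.
move=> i k u ilt hu; rewrite !ideal_part_supported ?(ltnW ilt) // => hxu.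
move=> al hal; have := hu al hal; rewrite ltnS leq_eqVlt.
case/orP=> [/eqP alk|]; last by left.
have [hl|nhl] := pselect (exists2 l : 'I_n, (l < i)%N & (0 < al l)%N).
  by right.
exfalso; pose o := Ordinal ilt.
have almin (l : 'I_n) : (l < o)%N -> al l = 0%N.
  move=> li; apply/eqP; rewrite -leqn0 leqNgt.
  by apply/negP => hl; apply: nhl; exists l.
suff : coord (var i *: u) (raise o al) != 0.
  move=> /hxu; rewrite /ideal_monomial mdegree_raise alk ltnn.
  move=> [//|[_ [l li]]].
  by rewrite ffunE almin // -val_eqE /= gtn_eqF.
have [s us hs] := coord_fin hcoord u.
have als : al \in s by apply: contraNT hal => /hs ->.
have eu := coord_expand hcoord coord_std us hs.
rewrite -[_ *: u]/(var i * u) (varE o) [in x o * u]eu mulr_sumr.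
rewrite (coord_sum hcoord).
have term be : coord (x o * (coord u be *: (std be : AR))) (raise o al) =
    sigma o (coord u be) * coord (x o * std be) (raise o al) +
    delta o (coord u be) * (be == raise o al)%:R.
  rewrite restr_scaleE -[_ *: _]/(iota (coord u be) * std be).
  by rewrite mulrA hsd mulrDl -mulrA (coordD hcoord) !coord_mull coord_std.
have nraise be : (mdegree be <= k)%N -> (be == raise o al) = false.
  move=> bek; apply/eqP => /(congr1 mdegree); rewrite mdegree_raise alk => e.
  by move: bek; rewrite e ltnn.
rewrite (bigD1_seq al) //= [X in _ + X]big1 ?addr0 => [|be neq].
  rewrite term std_raise // coord_std eqxx mulr1 nraise ?alk // mulr0 addr0.
  (* The coefficient is [sigma o (coord u al)], nonzero by injectivity of [sigma o]. *)
  rewrite -(sigma0 o) (inj_eq (bij_inj (hsigma o))); exact: hal.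
have [u0|ube] := eqVneq (coord u be) 0.
  by rewrite u0 scale0r mulr0 (coord0 hcoord).
have bek : (mdegree be <= k)%N by rewrite -ltnS; apply: hu.
(* Another monomial [be] contributes only to [raise o be] and to monomials of degree at most [k]. *)
have [r [b [e hb]]] := straightP be o.
rewrite term e nraise // mulr0 addr0 (coordD hcoord) coord_mull coord_std.
rewrite (inj_eq (@raise_inj o)) (negPf neq) mulr0 add0r.
have [->|/hb] := eqVneq (coord b (raise o al)) 0; first by rewrite mulr0.
by rewrite mdegree_raise alk !ltnS ltnNge bek.
Qed.

Lemma pbw_filt_top k u : pbw_filt k.+2 u -> IA (pbw_filt k.+1) n u.
Proof.
move=> hu; apply/ideal_part_supported => //; apply: supported_leq hu => al.
rewrite ltnS leq_eqVlt => /orP[/eqP alk|]; last by left.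
right; split=> //; have : (0 < mdegree al)%N by rewrite alk.
rewrite lt0n sum_nat_eq0 negb_forall => /existsP[l].
by rewrite -lt0n => hl; exists l.
Qed.

End Degree.

Lemma pbw_global_dimension_le m : lgld_le R m -> lgld_le A (n + m).
Proof.
have [coord [hcoord coord_std]] := pbw_coordinates hA.
apply: (global_dimension_le pbw_normal_generators (pbw_inj hA)
  (pbw_filtration hcoord coord_std) (pbw_filt_ex hcoord)
  (pbw_regular hcoord coord_std) (pbw_filt1 hcoord coord_std)).
exact: (pbw_filt_top hcoord coord_std).
Qed.

End PBWFiltration.

(** * Semi-graduations of finitely generated algebras *)

Local Open Scope classical_set_scope.

Section Span.
Variables (K : fieldType) (V : lmodType K).

Fixpoint span (s : seq V) (u : V) : Prop :=
  if s is b :: s' then exists k : K, span s' (u - k *: b) else u = 0.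

Fixpoint free_seq (s : seq V) : Prop :=
  if s is b :: s' then ~ span s' b /\ free_seq s' else True.

Lemma spanP s k u v : span s u -> span s v -> span s (k *: u + v).
Proof.
elim: s u v => [|b s IH] u v /=; first by move=> -> ->; rewrite scaler0 addr0.
move=> [k1 h1] [k2 h2]; exists (k * k1 + k2).
have -> : k *: u + v - (k * k1 + k2) *: b = k *: (u - k1 *: b) + (v - k2 *: b).
  by rewrite scalerDl -scalerA scalerBr opprD addrACA.
exact: IH.
Qed.

Lemma span0 s : span s 0.
Proof. by elim: s => //= b s IH; exists 0; rewrite scale0r subr0. Qed.

Lemma spanD s u v : span s u -> span s v -> span s (u + v).
Proof. by rewrite -[u in u + v]scale1r; apply: spanP. Qed.

Lemma spanZ s k u : span s u -> span s (k *: u).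
Proof.
by move=> h; rewrite -[_ *: _]addr0; apply: spanP => //; apply: span0.
Qed.

Lemma spanB s u v : span s u -> span s v -> span s (u - v).
Proof.
by move=> hu hv; apply: spanD => //; rewrite -scaleN1r; apply: spanZ.
Qed.

Lemma span_ind (Z : V -> Prop) s u : Z 0 ->
  (forall k u v, Z u -> Z v -> Z (k *: u + v)) -> (forall b, b \in s -> Z b) ->
  span s u -> Z u.
Proof.
move=> Z0 ZP; elim: s u => [|b s IH] u hZ /=; first by move=> ->.
move=> [k hk]; rewrite -[u](subrK (k *: b)) addrC; apply: ZP.
  by apply: hZ; rewrite inE eqxx.
by apply: IH hk => b' hb'; apply: hZ; rewrite inE hb' orbT.
Qed.

Lemma span_mem s b : b \in s -> span s b.
Proof.
elim: s => // b' s IH; rewrite inE => /orP[/eqP ->|/IH h].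
  by exists 1; rewrite scale1r subrr; apply: span0.
by exists 0; rewrite scale0r subr0.
Qed.

Lemma span_sub s t u : {subset s <= t} -> span s u -> span t u.
Proof.
move=> st; apply: span_ind => [|k v w|b /st]; first exact: span0.
  exact: spanP.
exact: span_mem.
Qed.

Lemma span_cat s t u : span (s ++ t) u ->
  exists v w, [/\ span s v, span t w & u = v + w].
Proof.
elim: s u => [|b s IH] u /=; first by exists 0, u; rewrite add0r.
move=> [k /IH[v [w [hv hw e]]]]; exists (v + k *: b), w; split=> //.
  by exists k; rewrite addrK.
by rewrite addrAC -e subrK.
Qed.

Lemma free_catr s t : free_seq (s ++ t) -> free_seq t.
Proof. by elim: s => //= b s IH [_]. Qed.

Lemma free_catl s t : free_seq (s ++ t) -> free_seq s.
Proof.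
elim: s => //= b s IH [nb /IH h]; split=> // hb; apply: nb.
by apply: span_sub hb => z hz; rewrite mem_cat hz.
Qed.

Lemma free_direct s t u v : free_seq (s ++ t) -> span s u -> span t v ->
  u + v = 0 -> u = 0.
Proof.
elim: s u => [|b s IH] u //= [nb hst] [k hk] hv e.
have [k0|k0] := eqVneq k 0.
  by apply: IH hv e => //; move: hk; rewrite k0 scale0r subr0.
case: nb.
have -> : b = (- k^-1) *: ((u - k *: b) + v).
  by rewrite addrAC e sub0r scalerN scaleNr opprK scalerA mulVf // scale1r.
apply: spanZ; apply: spanD.
  by apply: span_sub hk => z hz; rewrite mem_cat hz.
by apply: span_sub hv => z hz; rewrite mem_cat hz orbT.
Qed.

Lemma span_sumP s u :
  span s u <-> exists k : 'I_(size s) -> K, u = \sum_i k i *: s`_i.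
Proof.
split.
  elim: s u => [|b s IH] u /=; first by exists (fun=> 0); rewrite big_ord0.
  move=> [k /IH[f fE]]; exists (fun i => oapp f k (unlift ord0 i)).
  rewrite big_ord_recl unlift_none /= -[u](subrK (k *: b)) addrC fE.
  by congr (_ + _); apply: eq_bigr => i _; rewrite liftK.
move=> [k ->]; apply: (big_ind (span s)) => [||i _]; first exact: span0.
  exact: spanD.
by apply/spanZ/span_mem/mem_nth.
Qed.

Lemma free_sum s (k : 'I_(size s) -> K) : free_seq s ->
  \sum_i k i *: s`_i = 0 -> forall i, k i = 0.
Proof.
elim: s k => [|b s IH] k /=; first by move=> _ _ [].
move=> [nb hs]; rewrite big_ord_recl /= => e.
have hsp : span s (\sum_(i < size s) k (lift ord0 i) *: s`_i).
  by apply/span_sumP; exists (fun i => k (lift ord0 i)).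
have kb : k ord0 *: b = 0.
  apply: (free_direct (s := [:: b]) (t := s) _ _ hsp e) => //.
  by exists (k ord0); rewrite subrr.
have k0 : k ord0 = 0.
  move/eqP: kb; rewrite scaler_eq0 => /orP[/eqP //|/eqP b0].
  by case: nb; rewrite b0; apply: span0.
move: e; rewrite k0 scale0r add0r => /(IH _ hs) h i.
by have [j ->|->] := unliftP ord0 i.
Qed.

(** Selected vectors are appended at the end, next to [s], so that in [extend s c ++ s] each vector
    is independent of those to its right, as [free_seq] demands. *)
Fixpoint extend (s c : seq V) : seq V :=
  if c is b :: c' then
    if `[< span s b >] then extend s c' else rcons (extend (b :: s) c') b
  else [::].

Lemma extend_free s c : free_seq s -> free_seq (extend s c ++ s).
Proof.
elim: c s => //= b c IH s hs; case: asboolP => hb; first exact: IH.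
by rewrite cat_rcons; apply: IH.
Qed.

Lemma extend_sub s c : {subset extend s c <= c}.
Proof.
elim: c s => //= b c IH s z; case: asboolP => _.
  by rewrite inE => /IH ->; rewrite orbT.
by rewrite mem_rcons !inE => /orP[->|/IH ->]; rewrite ?orbT.
Qed.

Lemma extend_span s c b : b \in c -> span (extend s c ++ s) b.
Proof.
elim: c s => //= b' c IH s; rewrite inE; case: asboolP => hb' /orP[/eqP ->|hb].
- by apply: span_sub hb' => z hz; rewrite mem_cat hz orbT.
- exact: IH.
- by apply: span_mem; rewrite mem_cat mem_rcons inE eqxx.
- by rewrite cat_rcons; apply: IH.
Qed.

(** Candidates are tested in order against [s] and the earlier ones; an independent prefix is
    therefore accepted entirely. This keeps the variables in degree 1. *)
Lemma extend_prefix s c c' : free_seq (rev c ++ s) ->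
  {subset c <= extend s (c ++ c')}.
Proof.
elim: c s => //= b c IH s; rewrite rev_cons cat_rcons => h z.
have [nb _] := free_catr h.
rewrite inE; case: asboolP => // _; rewrite mem_rcons inE.
by case: eqP => //= _; apply: IH.
Qed.

End Span.

Section FinitelyGenerated.
Variables (K : fieldType) (A : algType K) (S : seq A).

Fixpoint words (k : nat) : seq A :=
  if k is k'.+1 then [seq s * w | s <- S, w <- words k'] else [:: 1].

Fixpoint basis_upto (k : nat) : seq A :=
  if k is k'.+1 then extend (basis_upto k') (words k) ++ basis_upto k'
  else [:: 1].

Definition basis_part (k : nat) : seq A :=
  if k is k'.+1 then extend (basis_upto k') (words k) else [:: 1].

(** A complement of the span of words of length below [k] in that of words of length at most [k]. *)
Definition word_grading (k : nat) : set A := [set u | span (basis_part k) u].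

Lemma words1 : words 1 = S.
Proof.
by rewrite /=; elim: (S) => //= s t IH; rewrite mulr1 IH.
Qed.

Lemma basis_upto_free k : free_seq (basis_upto k).
Proof.
elim: k => [|k IH] /=; last exact: extend_free.
by split=> //; apply/eqP/oner_neq0.
Qed.

Lemma basis_part_free k : free_seq (basis_part k).
Proof.
case: k => [|k]; first exact: (basis_upto_free 0).
exact: (free_catl (basis_upto_free k.+1)).
Qed.

Lemma basis_part_words k : {subset basis_part k <= words k}.
Proof. by case: k => // k; apply: extend_sub. Qed.

Lemma basis_upto_words k b : b \in basis_upto k ->
  exists2 j, (j <= k)%N & b \in words j.
Proof.
elim: k => [|k IH] /=; first by exists 0%N.
rewrite mem_cat => /orP[/extend_sub h|/IH[j jk h]]; first by exists k.+1.
by exists j => //; apply: leqW.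
Qed.

Lemma basis_upto_leq j k u : (j <= k)%N ->
  span (basis_upto j) u -> span (basis_upto k) u.
Proof.
move=> jk h; rewrite -(subnK jk); elim: (k - j)%N => // m IH.
by apply: span_sub IH => z hz; rewrite mem_cat hz orbT.
Qed.

Lemma span_word j k w : (j <= k)%N -> w \in words j -> span (basis_upto k) w.
Proof.
move=> jk hw; apply: (basis_upto_leq jk).
by case: j hw {jk} => [|j] hw; [apply: span_mem | apply: extend_span].
Qed.

Lemma words_cat j k w w' : w \in words j -> w' \in words k ->
  w * w' \in words (j + k).
Proof.
elim: j w => [|j IH] w; first by rewrite inE => /eqP ->; rewrite mul1r.
move=> /allpairsP[[s v] [hs hv ->]] hw' /=; rewrite -mulrA.
by apply/allpairsP; exists (s, v * w'); split=> //; apply: IH.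
Qed.

Lemma span_mul s t j k l u v :
  (forall b, b \in s -> exists2 j', (j' <= j)%N & b \in words j') ->
  (forall b, b \in t -> exists2 k', (k' <= k)%N & b \in words k') ->
  (j + k <= l)%N -> span s u -> span t v -> span (basis_upto l) (u * v).
Proof.
move=> hs ht jkl hu hv; move: hu.
apply: (span_ind (Z := fun u => span _ (u * v)))
  => [|k0 a b ha hb|b /hs[j' jj hb]].
- by rewrite mul0r; apply: span0.
- by rewrite mulrDl -scalerAl; apply: spanP.
move: hv.
apply: (span_ind (Z := fun v => span _ (b * v)))
  => [|k0 a c ha hc|c /ht[k' kk hc]].
- by rewrite mulr0; apply: span0.
- by rewrite mulrDr -scalerAr; apply: spanP.
by apply: span_word (words_cat hb hc); apply: leq_trans (leq_add jj kk) jkl.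
Qed.

Lemma partial_sumE k u :
  partial_sum word_grading k.+1 u <-> span (basis_upto k) u.
Proof.
split.
  move=> [f hf ->] {u}; elim: k => [|k IH].
    by rewrite big_ord1; exact: (hf 0%N).
  rewrite big_ord_recr /=; apply: spanD.
    by apply: span_sub IH => z hz; rewrite mem_cat hz orbT.
  by apply: span_sub (hf k.+1) => z hz; rewrite mem_cat hz.
elim: k u => [|k IH] u.
  move=> hu; exists (fun p => if p is 0%N then u else 0).
    by case=> // p; apply: span0.
  by rewrite big_ord1.
move=> /span_cat[v [w [hv /IH[f hf wE] ->]]].
exists (fun p => if p == k.+1 then v else f p).
  by move=> p; case: eqP => [->|_].
rewrite big_ord_recr /= eqxx addrC wE; congr (_ + _).
by apply: eq_bigr => i _; rewrite ltn_eqF.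
Qed.

Hypothesis hgen : forall D : set A, subring D -> (forall k : K, D k%:A) ->
  (forall s, s \in S -> D s) -> forall b, D b.

Lemma span_basis_upto b : exists k, span (basis_upto k) b.
Proof.
apply: (hgen (D := fun b => exists k, span (basis_upto k) b)).
- split; first by exists 0%N; apply: span_mem; rewrite inE.
    move=> u v [j hu] [k hv]; exists (j + k)%N; apply: spanB.
      by apply: basis_upto_leq hu; rewrite leq_addr.
    by apply: basis_upto_leq hv; rewrite leq_addl.
  move=> u v [j hu] [k hv]; exists (j + k)%N.
  by apply: (span_mul _ _ (leqnn _) hu hv) => c; apply: basis_upto_words.
- by move=> k; exists 0%N; apply/spanZ/span_mem; rewrite inE.
- by move=> s hs; exists 1%N; apply: (@span_word 1%N) => //; rewrite words1.
Qed.

Lemma word_grading_connected : connected word_grading.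
Proof.
apply/seteqP; split=> [u [k /eqP]|u [k _ <-]].
  by rewrite subr_eq0 => /eqP ->; exists k.
by apply/spanZ/span_mem; rewrite inE.
Qed.

Lemma word_grading_fsg : finitely_semi_graded word_grading.
Proof.
split.
- split.
  + by move=> p; split; [exact: span0 | move=> u v; exact: spanB].
  + split=> [b|N f hf].
      split=> // _; have [k hk] := span_basis_upto b.
      by exists k.+1; apply/partial_sumE.
    elim: N => [|N IH] // e p.
    (* The free list [basis_upto k.+1] is the part of degree [k.+1] followed by [basis_upto k], so
       the top component of a vanishing sum vanishes. *)
    have fN : f N = 0.
      case: N {IH} e => [|k]; first by rewrite big_ord1.
      rewrite big_ord_recr /= addrC.
      apply: (free_direct (basis_upto_free k.+1) (hf k.+1)).
      by apply/partial_sumE; exists f.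
    rewrite ltnS leq_eqVlt => /orP[/eqP -> //|].
    by apply: IH; move: e; rewrite big_ord_recr /= fN addr0.
  + move=> m p u v hu hv; apply/partial_sumE.
    apply: (span_mul _ _ (leqnn _) hu hv) => b /basis_part_words.
      by exists m.
    by exists p.
  + by apply: span_mem; rewrite inE.
- exists S => D hD D0 DS; apply/seteqP; split=> // b _.
  apply: hgen => // k; apply: D0.
  by rewrite word_grading_connected; exists k.
- move=> p; exists (size (basis_part p)), (fun i => (basis_part p)`_i).
  split=> [v|k hk e i].
    rewrite -[word_grading p v]/(span _ v) span_sumP.
    split=> [[k ->]|[k hk ->]].
      exists (fun i => (k i)%:A); last first.
        by apply: eq_bigr => i _; rewrite mulr_algl.
      by move=> i; rewrite word_grading_connected; exists (k i).
    have /choice[f fE] i : exists k0 : K, k0%:A = k i.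
      by have := hk i; rewrite word_grading_connected => -[k0 _ <-]; exists k0.
    by exists f; apply: eq_bigr => i _; rewrite -fE mulr_algl.
  have /choice[f fE] j : exists k0 : K, k0%:A = k j.
    by have := hk j; rewrite word_grading_connected => -[k0 _ <-]; exists k0.
  rewrite -fE (free_sum (k := f) (basis_part_free p)) ?scale0r //.
  by rewrite -[RHS]e; apply: eq_bigr => j _; rewrite -fE mulr_algl.
Qed.

End FinitelyGenerated.

(** * Generators of a skew PBW extension *)

Section Generators.
Variables (K : fieldType) (R A : algType K) (n : nat).
Variables (iota : {lrmorphism R -> A}) (x : 'I_n -> A).
Hypothesis hA : skew_PBW iota x.

Lemma pbw_free_vars (s : seq 'I_n) : uniq s ->
  free_seq ([seq x i | i <- s] ++ [:: 1]).
Proof.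
have [coord [hcoord coord_std]] := pbw_coordinates hA.
pose z : {ffun 'I_n -> nat} := [ffun=> 0%N].
have xE i : x i = std_monomial x (raise i z).
  by rewrite -std_raise ?std0 ?mulr1 // => l _; rewrite ffunE.
elim: s => [_|i s IH] /=; first by split=> //; apply/eqP/oner_neq0.
move=> /andP[hi us]; split; last exact: IH.
move=> hsp; have : coord (x i) (raise i z) = 0.
  move: hsp; apply: (span_ind (Z := fun u => coord u (raise i z) = 0)).
  - exact: (coord0 hcoord).
  - move=> k u v hu hv.
    rewrite -[k *: u]mulr_algl -(rmorph_alg iota).
    by rewrite (coordD hcoord) coord_mull // hu hv mulr0 addr0.
  move=> b; rewrite mem_cat => /orP[/mapP[j js ->]|].
    rewrite xE coord_std; case: eqP => // /ffunP/(_ j); rewrite !ffunE eqxx.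
    by case: eqP js hi => // -> ->.
  rewrite inE => /eqP ->; rewrite -(std0 x) coord_std; case: eqP => //.
  by move/(congr1 (@mdegree n)); rewrite mdegree_raise => /n_Sn.
by rewrite xE coord_std eqxx => /eqP; rewrite oner_eq0.
Qed.

Lemma pbw_generated (sR : seq R) (R_ : nat -> set R) : connected R_ ->
  (forall D, subring D -> R_ 0%N `<=` D -> (forall b, b \in sR -> D b) ->
     D = setT) ->
  forall D : set A, subring D -> (forall k : K, D k%:A) ->
  (forall s, s \in [seq x i | i <- enum 'I_n] ++ map iota sR -> D s) ->
  forall b, D b.
Proof.
move=> hconn hR D [D1 DB DM] DK DS b.
have D0 : D 0 by rewrite -(subrr 1); apply: DB.
have DD u v : D u -> D v -> D (u + v).
  move=> hu hv; rewrite -[v]opprK; apply: (DB) => //.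
  by rewrite -sub0r; apply: DB.
have Diota r : D (iota r).
  suff h : [set r | D (iota r)] = setT.
    by have : [set r | D (iota r)] r by rewrite h.
  apply: hR.
  - split=> [|u v|u v] /=; rewrite ?rmorph1 ?rmorphB ?rmorphM //.
      exact: DB.
    exact: DM.
  - by rewrite hconn => _ [k _ <-] /=; rewrite rmorph_alg.
  - by move=> s hs; apply: DS; rewrite mem_cat map_f ?orbT.
have Dx i : D (x i) by apply: DS; rewrite mem_cat map_f // mem_enum.
have [s [r ->]] := pbw_span hA b.
rewrite /std_combination; elim/big_ind: _ => // al _; apply: (DM) => //.
rewrite /std_monomial; elim/big_ind: _ => // i _.
elim: (al i) => [|m IH]; first by rewrite expr0.
by rewrite exprS; apply: DM.
Qed.

End Generators.

(** * Assembling the regularity conditions *)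

Lemma lgld_eq_ex (S : pzRingType) m : lgld_le S m -> exists d, lgld_eq S d.
Proof.
move=> hm; have ex : exists m, `[< lgld_le S m >] by exists m; apply/asboolP.
exists (ex_minn ex); case: ex_minnP => d /asboolP hd dmin; split=> // m' hm'.
exact/dmin/asboolP.
Qed.

Lemma trivial_mod_iso (S : pzRingType) (U V : lmodType S) :
  (forall u : U, u = 0) -> (forall v : V, v = 0) -> mod_iso U V.
Proof.
move=> U0 V0.
have l : linear (fun _ : U => 0 : V) by move=> a u v; rewrite scaler0 addr0.
have [f fE] := linear_ex l.
by exists f, (fun=> 0) => [u|v]; [rewrite [RHS]U0 | rewrite [RHS]V0].
Qed.

Lemma ge1_quotients_trivial (B : nzRingType) (gB : nat -> set B) :
  ge1_ideal gB 1 -> (forall y : left_quot_ge1 gB, y = 0) /\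
                    (forall y : right_quot_ge1 gB, y = 0).
Proof.
move=> h1; have hall b : ge1_ideal gB b.
  move=> I hI hp hs; have [_ _ hM] := hI.
  by rewrite -[b]mulr1; apply: (hM b 1 (h1 I hI hp hs)).1.
split=> y; have [v ->] := pi_quotmod_surj y; rewrite -pi_quotmod0.
  by apply/pi_quotmodE; rewrite subr0; apply/asboolP.
by apply/pi_quotmodE; rewrite subr0; apply/asboolP.
Qed.

Theorem theorem4p14 (K : fieldType) (R A : algType K) (n : nat)
  (iota : {lrmorphism R -> A}) (x : 'I_n -> A)
  (sigma delta : 'I_n -> R -> R)
  (c : 'I_n -> 'I_n -> R) (a : 'I_n -> 'I_n -> 'I_n -> R)
  (d : 'I_n -> 'I_n -> R) (R_ : nat -> set R)
  (hA : skew_PBW iota x)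
  (hsd : pbw_twists iota x sigma delta)
  (hcad : pbw_constants iota x c a d)
  (hbij : bijective_pbw sigma c)
  (hlgld : exists m, lgld_le R m)
  (hfsg : finitely_semi_graded R_)
  (hconn : connected R_)
  (hsigma : forall i, homogeneous R_ (sigma i))
  (hdelta : forall i, homogeneous R_ (delta i))
  (hd : exists i j (k : K), k != 0 /\ d i j = k%:A) :
  SAS A.
Proof.
have [sR hR] := fsg_generated hfsg.
have hgen := pbw_generated hA hconn hR.
set S := _ ++ _ in hgen.
have [m hm] := hlgld.
have [e he] := lgld_eq_ex (pbw_global_dimension_le hA hsd hcad hbij.1 hm).
have hx i : word_grading S 1 (x i).
  apply: span_mem; rewrite /basis_part words1.
  (* The variables form a prefix of [S], and degree 1 is selected over [basis_upto _ 0 = [:: 1]]. *)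
  apply: extend_prefix; last by rewrite map_f // mem_enum.
  rewrite -map_rev; apply: (pbw_free_vars hA).
  by rewrite rev_uniq enum_uniq.
have h1 : ge1_ideal (word_grading S) 1.
  move=> I [I0 ID IM] hp _.
  have Ix i : I (x i) by apply: (hp 1%N) => //; apply: hx.
  have [i [j [k [k0 dk]]]] := hd.
  have IN u : I u -> I (- u).
    by move=> hu; rewrite -mulN1r; apply: (IM (-1) u hu).1.
  have Ik : I k%:A.
    have := hcad i j; rewrite dk rmorph_alg.
    set s := \sum_k _; set p := iota _ * _ => e0.
    (* Solved for its constant term, the relation expresses [k] by terms that each contain a
       variable and so lie in [I]. *)
    have -> : k%:A = x j * x i - p - s.
      by rewrite e0 -addrA -opprD addrC addKr.
    have Ip : I p by apply: (IM _ _ _).1; apply: (IM _ _ _).1; apply: Ix.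
    have Is : I s.
      rewrite /s; elim/big_ind: _ => // l _.
      by apply: (IM _ _ _).1; apply: Ix.
    apply: (ID); last exact: (IN).
    by apply: ID; [apply: (IM _ _ _).1; apply: Ix | apply: (IN)].
  have -> : 1 = k^-1%:A * k%:A :> A.
    by rewrite -scalerAl mul1r scalerA mulVf // scale1r.
  exact: (IM _ _ Ik).1.
have [hl hr] := ge1_quotients_trivial h1.
exists (word_grading S), e; split.
- exact: word_grading_fsg.
- exact: word_grading_connected.
- exact: he.
(* Both quotients by the ideal are zero, so every Ext module vanishes, and in degree [e] the
   required isomorphism is between zero modules. *)
move=> P; split=> [i _|]; first exact: Ext_zero_module.
by apply: trivial_mod_iso => //; apply: Ext_zero_module.
Qed.
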